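(* Under the CFL conditions listed in the context, the forward Euler DG scheme for systems $\mathbf u_h^{n+1,(\mathrm{pre})}=\mathbf u_h^n+\Delta t\,\mathcal L_h(\mathbf u_h^n)$ equipped with the entropy stable (ES) limiter $$\mathbf u_h^{n+1}|_{I_i}=\bar{\mathbf u}_i^{n+1}+\theta_i\big(\mathbf u_h^{n+1,(\mathrm{pre})}|_{I_i}-\bar{\mathbf u}_i^{n+1}\big),\qquad \theta_i=\min\Big\{\frac{\mathcal U^{\mathrm{up}}-\mathcal U^{\mathrm{1st}}}{\mathcal U^{\mathrm{high}}-\mathcal U^{\mathrm{1st}}},1\Big\}$$ on every cell $I_i$ (with $\theta_i=1$ if $\mathcal U^{\mathrm{high}}=\mathcal U^{\mathrm{1st}}$) is entropy stable in the sense that $$\int_{\mathbb R}^{\langle N\rangle}\mathcal U(\mathbf u_h^{n+1})\,dx\le\int_{\mathbb R}^{\langle N\rangle}\mathcal U(\mathbf u_h^n)\,dx.$$ Here $\bar{\mathbf u}_i^{n+1}$ is the cell average of $\mathbf u_h^{n+1,(\mathrm{pre})}$ on $I_i$, $\mathcal U^{\mathrm{1st}}=\mathcal U(\bar{\mathbf u}_i^{n+1})$, $\mathcal U^{\mathrm{high}}=\tilde{\mathcal U}_i^{n+1,(\mathrm{pre})}$ and $\mathcal U^{\mathrm{up}}=\tilde{\mathcal U}_i^n-\lambda(\hat{\mathcal F}_{i+1/2}-\hat{\mathcal F}_{i-1/2})$.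
   Context: System of conservation laws $\mathbf u_t+\mathbf f(\mathbf u)_x=\mathbf 0$, $x\in\mathbb R$, $t>0$, with $\mathbf u\in\mathcal D\subset\mathbb R^p$, $\mathbf f:\mathcal D\to\mathbb R^p$. Uniform mesh: $\mathbb R=\bigcup_{i\in\mathbb Z}I_i$, $I_i=[x_{i-1/2},x_{i+1/2}]$ of length $\Delta x$; time step $\Delta t$, $\lambda=\Delta t/\Delta x$. $\mathbf V_h^k$ is the space of $\mathbb R^p$-valued functions whose components are polynomials of degree at most $k$ on each $I_i$; $\mathbf u_h^n\in\mathbf V_h^k$; $\mathbf w_{i+1/2}^{-},\mathbf w_{i+1/2}^{+}$ are the traces at $x_{i+1/2}$ from $I_i$ and $I_{i+1}$. Lax–Friedrichs flux: $\hat{\mathbf f}(\mathbf u^-,\mathbf u^+)=\frac12(\mathbf f(\mathbf u^+)+\mathbf f(\mathbf u^-))-\frac\alpha2(\mathbf u^+-\mathbf u^-)$, where $\alpha=\alpha(\mathbf u^-,\mathbf u^+)\ge\max\{|\sigma_{\min}|,|\sigma_{\max}|\}$ and $\sigma_{\min},\sigma_{\max}$ are the minimum and maximum wave speeds of the Riemann problem with left state $\mathbf u^-$ and right state $\mathbf u^+$. With $\hat{\mathbf f}_{i+1/2}=\hat{\mathbf f}(\mathbf u_{h,i+1/2}^-,\mathbf u_{h,i+1/2}^+)$, the DG operator $\mathcal L_h(\mathbf u_h)\in\mathbf V_h^k$ is defined by $$\int_{I_i}\mathcal L_h(\mathbf u_h)\cdot\mathbf w\,dx=\int_{I_i}\mathbf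 f(\mathbf u_h)\cdot\mathbf w_x\,dx-\hat{\mathbf f}_{i+1/2}\cdot\mathbf w_{i+1/2}^-+\hat{\mathbf f}_{i-1/2}\cdot\mathbf w_{i-1/2}^+\quad\forall\mathbf w\in\mathbf V_h^k,\ \forall i.$$ Entropy pair: $\mathcal U\in C^2(\mathcal D)$ convex, $\mathcal F'(\mathbf u)=\mathcal U'(\mathbf u)\mathbf f'(\mathbf u)$. Proper numerical entropy flux of the Lax–Friedrichs flux: $\hat{\mathcal F}(\mathbf u^-,\mathbf u^+)=\frac12(\mathcal F(\mathbf u^+)+\mathcal F(\mathbf u^-))-\frac12\alpha(\mathcal U(\mathbf u^+)-\mathcal U(\mathbf u^-))$; $\hat{\mathcal F}_{i+1/2}=\hat{\mathcal F}(\mathbf u_{i+1/2}^{n,-},\mathbf u_{i+1/2}^{n,+})$, evaluated at the traces of $\mathbf u_h^n$. Quadrature: $2N-3\ge k$; $\int_{I_i}^{\langle N\rangle}g\,dx=\Delta x\sum_{q=1}^N\omega_q g(\hat x_{i,q})$ is the $N$-point Gauss–Lobatto rule on $I_i$, with weights normalized so that $\sum_q\omega_q=1$; $\int_{\mathbb R}^{\langle N\rangle}g\,dx=\sum_{i}\int_{I_i}^{\langle N\rangle}g\,dx$. $\tilde{\mathcal U}_i^n=\frac1{\Delta x}\int_{I_i}^{\langle N\rangle}\mathcal U(\mathbf u_h^n)\,dx$, and similarly $\tilde{\mathcal U}_i^{n+1,(\mathrm{pre})}$ for $\mathbf u_h^{n+1,(\mathrm{pre})}$. CFL conditions (for all $i$):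 $\lambda\max\{\alpha_i,\alpha_{i+1/2}\}\le\frac{\omega_N}2$ and $\lambda\max\{\alpha_{i-1/2},\alpha_i\}\le\frac{\omega_1}2$, where $\alpha_{i+1/2}=\alpha(\mathbf u_{i+1/2}^{n,-},\mathbf u_{i+1/2}^{n,+})$ and $\alpha_i=\alpha(\mathbf u_{i-1/2}^{n,+},\mathbf u_{i+1/2}^{n,-})$.
   Formalization: Added assumption: the traces of u_h^n tend to one constant state in D at both ends of the line and both entropy sums over all cells converge; without it entropy can flow in from infinity and the inequality fails. *)

(* Defs.v *)
From HB Require Import structures.
From mathcomp Require Import all_boot all_order all_algebra.
From mathcomp Require Import all_classical all_reals all_analysis.

Set Implicit Arguments.
Unset Strict Implicit.
Unset Printing Implicit Defensive.
Import Order.TTheory GRing.Theory Num.Theory.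
Import numFieldNormedType.Exports.

Local Open Scope classical_set_scope.
Local Open Scope ring_scope.

Section Smoothness.
Context {R : realType} {V W : normedModType R}.

(* Used for open [A] and finite-dimensional [V], where continuity of the
   differential in each fixed direction is continuity in operator norm. *)
Definition C1_on (A : set V) (f : V -> W) :=
  forall x, A x -> differentiable f x /\
    forall v, {for x, continuous (fun y => 'd f y v)}.

Definition C2_on (A : set V) (f : V -> W) :=
  forall x, A x -> differentiable f x /\
    forall v, C1_on A (fun y => 'd f y v : W).

End Smoothness.

Section ConservationLaw.
Context {R : realType} {p : nat}.
Local Notation state := 'rV[R]_p.
Local Notation mu := (@lebesgue_measure R).

(* [f] and the entropy pair [(U, F)] are total functions; only their values on
   the open convex set of states [D] matter. *)
Definition entropy_pair (D : set state) (f : state -> state)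
    (U F : state -> R) :=
  [/\ convex_function D U, C2_on D U
    & forall u, D u -> differentiable F u /\
        forall v, 'd F u v = 'd U u ('d f u v)].

(* Test functions phi(x, t) are the restrictions to R x [0, +oo[ of compactly
   supported C^1 functions on R^2. *)
Definition test_function (phi : R * R -> R) :=
  C1_on setT phi /\ exists r : R, forall z, r < `|z| -> phi z = 0.

(* For g = g(x/t), h = h(x/t) and Riemann data gl, gr:
   \iint_{t > 0} (g phi_t + h phi_x) dx dt + \int g_0(x) phi(x, 0) dx, which is
   minus the pairing of g_t + h_x, initial data included, with phi. *)
Definition riemann_weak_form (g h : R -> R) (gl gr : R) (phi : R * R -> R) : R :=
  \int[mu]_(t in `]0, +oo[)
    (\int[mu]_x (g (x / t) * 'd phi (x, t) (0, 1)
               + h (x / t) * 'd phi (x, t) (1, 0)))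
  + \int[mu]_x ((if x < 0 then gl else gr) * phi (x, 0)).

(* [w], as the function (x, t) |-> w (x / t), is a self-similar weak solution
   with values in [D] and finite speed of propagation, satisfying the entropy
   inequality for the one pair [(U, F)]: entropy solutions satisfy it for every
   entropy pair. *)
Record riemann_solution (D : set state) (f : state -> state) (U F : state -> R)
    (ul ur : state) (w : R -> state) : Prop := RiemannSolution {
  riemann_dom : forall xi, D (w xi);
  riemann_finite_speed : exists r : R,
    (forall xi, xi < - r -> w xi = ul) /\ (forall xi, r < xi -> w xi = ur);
  riemann_integrable : forall j,
    locally_integrable setT (fun xi => w xi 0 j) /\
    locally_integrable setT (fun xi => f (w xi) 0 j);
  riemann_entropy_integrable :
    locally_integrable setT (U \o w) /\ locally_integrable setT (F \o w);
  riemann_weak : forall phi, test_function phi -> forall j,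
    riemann_weak_form (fun xi => w xi 0 j) (fun xi => f (w xi) 0 j)
      (ul 0 j) (ur 0 j) phi = 0;
  riemann_entropy : forall phi, test_function phi -> (forall z, 0 <= phi z) ->
    0 <= riemann_weak_form (U \o w) (F \o w) (U ul) (U ur) phi }.

(* The edges of the Riemann fan. When [w] is constant there is no wave and both
   are 0, by the convention that [sup] and [inf] are 0 on unbounded sets. *)
Definition min_wave_speed (ul : state) (w : R -> state) : R :=
  sup [set s | forall xi, xi < s -> w xi = ul].
Definition max_wave_speed (ur : state) (w : R -> state) : R :=
  inf [set s | forall xi, s < xi -> w xi = ur].

Definition riemann_speed_bound (D : set state) (f : state -> state)
    (U F : state -> R) (ul ur : state) (a : R) :=
  exists2 w, riemann_solution D f U F ul ur w
    & Num.max `|min_wave_speed ul w| `|max_wave_speed ur w| <= a.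

Definition lf_flux (f : state -> state) (alpha : state -> state -> R)
    (ul ur : state) : state :=
  2^-1 *: (f ur + f ul) - (alpha ul ur / 2) *: (ur - ul).

Definition lf_entropy_flux (U F : state -> R) (alpha : state -> state -> R)
    (ul ur : state) : R :=
  2^-1 * (F ur + F ul) - 2^-1 * alpha ul ur * (U ur - U ul).

End ConservationLaw.

Section DG.
Context {R : realType} {p : nat}.
Local Notation state := 'rV[R]_p.
Local Notation mu := (@lebesgue_measure R).

(* [u i] holds the polynomials, in the physical variable x, of the p components
   of u on the cell I_i. *)
Definition dgfun := int -> 'rV[{poly R}]_p.

Definition in_Vh (k : nat) (u : dgfun) :=
  forall i j, (size (u i 0%R j) <= k.+1)%N.

Definition dgval (u : dgfun) (i : int) (x : R) : state :=
  \row_j (u i 0 j).[x].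

Definition dg_deriv (u : dgfun) : dgfun := fun i => map_mx (@deriv R) (u i).

Definition dotv (a b : state) : R := \sum_j a 0 j * b 0 j.

Section Mesh.
(* [xc] is the centre of the cell I_0. *)
Variables (xc dx : R).

(* x_{i+1/2} *)
Definition xhalf (i : int) : R := xc + (i%:~R + 2^-1) * dx.

Definition cell (i : int) : set R := `[xhalf (i - 1), xhalf i].

(* The traces u_{i+1/2}^- and u_{i+1/2}^+: half-integer indices i+1/2 are
   encoded as i throughout. *)
Definition trace_minus (u : dgfun) (i : int) : state := dgval u i (xhalf i).
Definition trace_plus (u : dgfun) (i : int) : state := dgval u (i + 1) (xhalf i).

Definition is_dg_operator (k : nat) (f : state -> state)
    (alpha : state -> state -> R) (u Lu : dgfun) :=
  let fhat i := lf_flux f alpha (trace_minus u i) (trace_plus u i) in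
  in_Vh k Lu /\ forall w, in_Vh k w -> forall i,
    \int[mu]_(x in cell i) dotv (dgval Lu i x) (dgval w i x) =
    \int[mu]_(x in cell i) dotv (f (dgval u i x)) (dgval (dg_deriv w) i x)
    - dotv (fhat i) (trace_minus w i)
    + dotv (fhat (i - 1)) (trace_plus w (i - 1)).

Definition cell_average (u : dgfun) (i : int) : state :=
  \row_j (dx^-1 * \int[mu]_(x in cell i) dgval u i x 0 j).

(* x_{i,q}, for nodes [xi] on the reference cell [-1, 1] *)
Definition node (xi : nat -> R) (i : int) (q : nat) : R :=
  xc + i%:~R * dx + dx / 2 * xi q.

(* [g i] is the integrand on I_i, which at a common endpoint of two cells may
   differ from that on the neighbouring cell. *)
Definition cell_quad (N : nat) (xi om : nat -> R) (g : int -> R -> R)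
    (i : int) : R :=
  dx * \sum_(1 <= q < N.+1) om q * g i (node xi i q).

Definition line_quad_partial (N : nat) (xi om : nat -> R) (g : int -> R -> R)
    (m : nat) : R :=
  \sum_(j < m.*2.+1) cell_quad N xi om g (j%:Z - m%:Z).

(* The sum over i in Z is taken as the limit of the sums over |i| <= m. *)
Definition line_quad (N : nat) (xi om : nat -> R) (g : int -> R -> R) : R :=
  limn (line_quad_partial N xi om g).

Definition far_field (u : dgfun) (uinf : state) :=
  forall e : R, 0 < e -> exists M : nat, forall i : int, (M < `|i|)%N ->
    `|trace_minus u i - uinf| < e /\ `|trace_plus u i - uinf| < e.

End Mesh.

(* The N-point Gauss-Lobatto rule on [-1, 1], with nodes [xi 1 < ... < xi N] and
   weights [om 1, ..., om N] normalized to have sum 1: the rule that has both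
   endpoints among its nodes and is exact in degree <= 2N - 3. *)
Definition gauss_lobatto (N : nat) (xi om : nat -> R) :=
  [/\ xi 1%N = -1, xi N = 1,
      forall q, (1 <= q < N)%N -> xi q < xi q.+1
    & forall P : {poly R}, (size P + 2 <= 2 * N)%N ->
        \sum_(1 <= q < N.+1) om q * P.[xi q]
        = 2^-1 * \int[mu]_(x in `[-1, 1]) P.[x] ].

Definition forward_euler (dt : R) (u Lu : dgfun) : dgfun :=
  fun i => u i + dt%:P *: Lu i.

Definition scale_about (c : state) (theta : R) (v : 'rV[{poly R}]_p) :
    'rV[{poly R}]_p :=
  map_mx polyC c + theta%:P *: (v - map_mx polyC c).

Definition es_theta (Uup U1st Uhigh : R) : R :=
  if Uhigh == U1st then 1 else Num.min ((Uup - U1st) / (Uhigh - U1st)) 1.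

(* Result of the limiter applied to [upre], [u] being the solution at the old
   time level. *)
Definition es_limiter (xc dx dt : R) (N : nat) (xi om : nat -> R)
    (U F : state -> R) (alpha : state -> state -> R) (u upre : dgfun) : dgfun :=
  let Fhat i := lf_entropy_flux U F alpha
                  (trace_minus xc dx u i) (trace_plus xc dx u i) in
  let Utilde v i :=
    dx^-1 * cell_quad xc dx N xi om (fun i x => U (dgval v i x)) i in
  fun i =>
    let ubar := cell_average xc dx upre i in
    let Uup := Utilde u i - dt / dx * (Fhat i - Fhat (i - 1)) in
    scale_about ubar (es_theta Uup (U ubar) (Utilde upre i)) (upre i).

End DG.

(* Main.v *)
(* Testing the weak form and the entropy inequality of a Riemann solution with
   one product cutoff phi(x, t) = bump b x * bump 0 t, equal to 1 in x on the
   fan |x| <= b, gives the two balances of Harten, Lax and van Leer over the fan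
   [-b, b]. Jensen's inequality for the average of the solution (which stays in
   the open convex set D by Hahn-Banach separation) then shows that the
   Lax-Friedrichs intermediate state
     m = (ul + ur) / 2 - (f ur - f ul) / (2 a)
   lies in D and satisfies
     U m <= (U ul + U ur) / 2 - (F ur - F ul) / (2 a).
   By exactness of the quadrature, and after adding and subtracting the flux
   between the two traces inside each cell, the new cell average is under the CFL
   conditions a convex combination of interior nodal values, the two traces and
   such intermediate states, so U^1st <= U^up. The limiter then brings the
   quadrature entropy of the cell below U^up, and summing over cells telescopes
   the numerical entropy fluxes, whose far-field values cancel. *)
Require Import Defs.
From HB Require Import structures.
From mathcomp Require Import all_boot all_order all_algebra.
From mathcomp Require Import all_classical all_reals all_analysis.
From mathcomp Require Import measurable_realfun zify ring lra.
Import Order.TTheory GRing.Theory Num.Theory.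
Import numFieldNormedType.Exports.
Local Open Scope classical_set_scope.
Local Open Scope ring_scope.

Set Implicit Arguments.
Unset Strict Implicit.
Unset Printing Implicit Defensive.

(** * Conic hull of an epigraph *)

Section Perspective.
Context {R : realType} {V : lmodType R}.
Implicit Types (D : set V) (U : V -> R).

Lemma convex_setP D (t : R) (x y : V) : convex_set D -> 0 <= t -> t <= 1 ->
  D x -> D y -> D (t *: x + (1 - t) *: y).
Proof.
move=> cD t0 t1 Dx Dy.
have := cD x y (Itv01 t0 t1) (mem_set Dx) (mem_set Dy).
by rewrite inE.
Qed.

Lemma convex_functionP D U (t : R) (x y : V) : convex_function D U ->
  0 <= t -> t <= 1 -> D x -> D y ->
  U (t *: x + (1 - t) *: y) <= t * U x + (1 - t) * U y.
Proof.
move=> cU t0 t1 Dx Dy.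
exact: (cU (Itv01 t0 t1) x y (mem_set Dx) (mem_set Dy)).
Qed.

(* The conic hull of the epigraph of [U] over [D], together with the vertical
   ray: Jensen's inequality says that it is closed under addition. *)
Definition persp_epi D U (s : R) (x : V) (r : R) :=
  [/\ s = 0, x = 0 & 0 <= r] \/
  [/\ 0 < s, D (s^-1 *: x) & s * U (s^-1 *: x) <= r].

(** Weight zero is allowed and falls on the degenerate ray, so nonnegative coefficients need no case
    split later. *)
Lemma persp_epi_point D U s v : 0 <= s -> D v ->
  persp_epi D U s (s *: v) (s * U v).
Proof.
rewrite le_eqVlt => /orP[/eqP <-|s0] Dv.
  by left; rewrite scale0r mul0r.
by right; rewrite scalerA mulVf ?gt_eqF// scale1r.
Qed.

Lemma persp_epi_le D U s x r r' : persp_epi D U s x r -> r <= r' ->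
  persp_epi D U s x r'.
Proof.
by move=> [[-> -> r0]|[s0 Ds Us]] rr'; [left|right]; split => //; apply: le_trans rr'.
Qed.

Lemma persp_epiZ D U c s x r : 0 <= c -> persp_epi D U s x r ->
  persp_epi D U (c * s) (c *: x) (c * r).
Proof.
rewrite le_eqVlt => /orP[/eqP <-|c0].
  by move=> _; left; rewrite !mul0r scale0r.
move=> [[-> -> r0]|[s0 Ds Us]].
  by left; rewrite mulr0 scaler0 mulr_ge0// ltW.
right; have -> : (c * s)^-1 *: (c *: x) = s^-1 *: x.
  by rewrite scalerA; congr (_ *: _); field; rewrite !gt_eqF.
by split=> //; [rewrite mulr_gt0|rewrite -mulrA ler_pM2l].
Qed.

Lemma persp_epiD D U s x r s' x' r' : convex_set D -> convex_function D U ->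
  persp_epi D U s x r -> persp_epi D U s' x' r' ->
  persp_epi D U (s + s') (x + x') (r + r').
Proof.
move=> cD cU [[-> -> r0]|[s0 Ds Us]].
  by rewrite !add0r => /persp_epi_le; apply; rewrite lerDr.
move=> [[-> -> r0']|[s0' Ds' Us']].
  rewrite !addr0; apply: (@persp_epi_le _ _ _ _ r); last by rewrite lerDl.
  by right.
have ss0 : 0 < s + s' by rewrite addr_gt0.
(* Normalizing by the total weight turns the sum into a convex combination with this coefficient. *)
set t := s / (s + s').
have t0 : 0 <= t by rewrite divr_ge0// ltW.
have t1 : t <= 1 by rewrite ler_pdivrMr// mul1r lerDl ltW.
have e : (s + s')^-1 *: (x + x')
    = t *: (s^-1 *: x) + (1 - t) *: (s'^-1 *: x').
  rewrite scalerDr !scalerA; congr (_ *: _ + _ *: _); rewrite /t; field;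
    by rewrite !gt_eqF.
right; rewrite e; split=> //; first exact: convex_setP.
have := convex_functionP cU t0 t1 Ds Ds'; rewrite -(ler_pM2l ss0) => /le_trans.
apply; suff -> : (s + s') * (t * U (s^-1 *: x) + (1 - t) * U (s'^-1 *: x'))
   = s * U (s^-1 *: x) + s' * U (s'^-1 *: x') by rewrite lerD.
by rewrite /t; field; rewrite gt_eqF.
Qed.

Lemma persp_epi_sum D U (I : Type) (l : seq I) (P : pred I) (s : I -> R)
    (x : I -> V) (r : I -> R) :
  convex_set D -> convex_function D U ->
  (forall i, P i -> persp_epi D U (s i) (x i) (r i)) ->
  persp_epi D U (\sum_(i <- l | P i) s i) (\sum_(i <- l | P i) x i)
                (\sum_(i <- l | P i) r i).
Proof.
move=> cD cU H; elim/big_rec3: _ => [|i s' x' r' Pi H']; first by left.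
by apply: persp_epiD => //; exact: H.
Qed.

(** A total weight of one excludes the vertical ray, so membership is Jensen's inequality together
    with the fact that the point stays in [D]. *)
Lemma persp_epi1 D U x r : persp_epi D U 1 x r -> D x /\ U x <= r.
Proof.
case=> [[/eqP]|[_]]; first by rewrite oner_eq0.
by rewrite invr1 scale1r mul1r.
Qed.

End Perspective.

(** * Hahn-Banach separation in finite dimension *)

Section HahnBanach.
Context {R : realType} {V : lmodType R}.

Definition sublinear (q : V -> R) :=
  (forall x y, q (x + y) <= q x + q y) /\
  (forall c x, 0 < c -> q (c *: x) = c * q x).

Lemma sublinear0 q : sublinear q -> q 0 = 0.
Proof.
move=> [_ h]; have := h 2 0 ltac:(by rewrite ltr0n); rewrite scaler0 => e; lra.
Qed.

Lemma sublinearN_ge q x : sublinear q -> - q x <= q (- x).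
Proof.
move=> sq; have := sq.1 x (- x); rewrite subrr sublinear0// => h; lra.
Qed.

(** Subadditivity on [t *: x = (y + t *: x) - y] bounds the infimum defining [tilt] from below. *)
Lemma sublinear_tilt_lb q x y t : sublinear q -> 0 <= t ->
  - q (- y) <= q (y + t *: x) - t * q x.
Proof.
move=> sq; rewrite le_eqVlt => /orP[/eqP <-|t0].
  by rewrite scale0r addr0 mul0r subr0 lerNl sublinearN_ge.
have := sq.1 (y + t *: x) (- y); rewrite addrAC subrr add0r sq.2// => h; lra.
Qed.

(* Makes [q] linear along [x] without changing its value there. *)
Definition tilt (q : V -> R) (x y : V) : R :=
  inf [set q (y + t *: x) - t * q x | t in [set t | 0 <= t]].

Lemma tilt_has_inf q x y : sublinear q ->
  has_inf [set q (y + t *: x) - t * q x | t in [set t | 0 <= t]].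
Proof.
move=> sq; split; first by exists (q (y + 0 *: x) - 0 * q x), 0 => /=.
by exists (- q (- y)) => _ [t /= t0 <-]; exact: sublinear_tilt_lb.
Qed.

Lemma tilt_le q x y t : sublinear q -> 0 <= t ->
  tilt q x y <= q (y + t *: x) - t * q x.
Proof.
move=> sq t0; apply: ge_inf; last by exists t.
by case: (tilt_has_inf x y sq).
Qed.

Lemma tilt_ge q x y c : sublinear q ->
  (forall t, 0 <= t -> c <= q (y + t *: x) - t * q x) -> c <= tilt q x y.
Proof.
move=> sq h; apply: lb_le_inf; first by case: (tilt_has_inf x y sq).
by move=> _ [t /= t0 <-]; exact: h.
Qed.

Lemma tilt_sublinear q x : sublinear q -> sublinear (tilt q x).
Proof.
move=> sq; split=> [y z|c y c0]; last first.
  apply/le_anti/andP; split.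
    rewrite -ler_pdivrMl//; apply: tilt_ge => // t t0.
    rewrite ler_pdivrMl//; apply: (le_trans (tilt_le x (c *: y) sq (t := c * t) _)).
      by rewrite mulr_ge0// ltW.
    by rewrite -scalerA -scalerDr sq.2// mulrBr mulrA.
  apply: tilt_ge => // t t0; rewrite -ler_pdivlMl//.
  apply: (le_trans (tilt_le x y sq (t := c^-1 * t) _)).
    by rewrite mulr_ge0// invr_ge0 ltW.
  have -> : y + (c^-1 * t) *: x = c^-1 *: (c *: y + t *: x).
    by rewrite scalerDr !scalerA mulVf ?gt_eqF// scale1r.
  by rewrite sq.2 ?invr_gt0// mulrBr mulrA.
rewrite -lerBlDr; apply: tilt_ge => // t t0; rewrite lerBlDr -lerBlDl.
apply: tilt_ge => // s s0; rewrite lerBlDl.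
apply: (le_trans (tilt_le x (y + z) sq (t := t + s) _)); first by rewrite addr_ge0.
have -> : y + z + (t + s) *: x = (y + t *: x) + (z + s *: x).
  by rewrite scalerDl addrACA.
have := sq.1 (y + t *: x) (z + s *: x) => h; lra.
Qed.

Lemma tilt_le0 q x y : sublinear q -> tilt q x y <= q y.
Proof.
move=> sq; apply: le_trans (tilt_le x y sq (lexx 0)) _.
by rewrite scale0r addr0 mul0r subr0.
Qed.

(** The choice [t = 1] gives one inequality, the uniform lower bound the other. Since also
    [tilt q x x <= q x], the tilted function becomes odd along [x]. *)
Lemma tiltN q x : sublinear q -> tilt q x (- x) = - q x.
Proof.
move=> sq; apply/le_anti/andP; split.
  apply: le_trans (tilt_le x (- x) sq ler01) _.
  by rewrite scale1r addNr sublinear0// mul1r add0r.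
by apply: tilt_ge => // t t0; have := sublinear_tilt_lb x (- x) sq t0; rewrite opprK.
Qed.

(** The chain [q x = - q (- x) <= - q' (- x) <= q' x <= q x] collapses. Oddness won along one vector
    therefore survives later tilts. *)
Lemma sublinear_odd_le q q' x : sublinear q' -> (forall y, q' y <= q y) ->
  q (- x) = - q x -> q' x = q x /\ q' (- x) = - q' x.
Proof.
move=> sq' le qN; have := sublinearN_ge x sq'.
have := le x; have := le (- x); rewrite qN => h1 h2 h3; split; lra.
Qed.

(* Tilting along the vectors of [s] one after the other. *)
Lemma sublinear_minorant q (s : seq V) : sublinear q ->
  exists2 L, sublinear L /\ (forall y, L y <= q y) &
    forall x, x \in s -> L (- x) = - L x.
Proof.
elim: s q => [|x s IHs] q sq; first by exists q.
have [L [sL Lle] Ls] := IHs _ (tilt_sublinear x sq).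
exists L; first by split=> // y; apply: le_trans (Lle y) (tilt_le0 _ _ sq).
have tN : tilt q x (- x) = - tilt q x x.
  apply/le_anti/andP; split; last exact/sublinearN_ge/tilt_sublinear.
  by rewrite tiltN// lerN2 tilt_le0.
move=> y; rewrite inE => /orP[/eqP ->|]; last exact: Ls.
exact: (sublinear_odd_le sL Lle tN).2.
Qed.

Lemma sublinear_oddZ L x c : sublinear L -> L (- x) = - L x ->
  L (c *: x) = c * L x.
Proof.
move=> sL LN; have [c0|c0|->] := ltgtP c 0.
- have -> : c *: x = (- c) *: (- x) by rewrite scaleNr scalerN opprK.
  by rewrite sL.2 ?oppr_gt0// LN mulrNN.
- by rewrite sL.2.
- by rewrite scale0r mul0r sublinear0.
Qed.

Lemma sublinear_oddD L x y : sublinear L -> L (- x) = - L x ->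
  L (x + y) = L x + L y.
Proof.
move=> sL LN; apply/le_anti; rewrite sL.1 /=.
by have := sL.1 (x + y) (- x); rewrite addrAC subrr add0r LN => h; lra.
Qed.

End HahnBanach.

(** * Minkowski gauge and separation of a point from an open convex set *)

Section Separation.
Context {R : realType} {p : nat}.
Local Notation V := 'rV[R]_p.

(** A sublinear minorant that is odd along all unit vectors is linear. Tilting along [m] first
    forces [L (- m) <= - q m], and oddness at [m] turns this into [q m <= L m]. *)
Lemma finite_hahn_banach (q : V -> R) (m : V) : sublinear q ->
  exists2 l : 'I_p -> R, (forall y : V, \sum_j l j * y 0 j <= q y) &
    \sum_j l j * m 0 j = q m.
Proof.
move=> sq.
have [L [sL Lle] Lodd] := sublinear_minorant
  (m :: [seq delta_mx 0 j | j : 'I_p]) (tilt_sublinear m sq).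
have LE (y : V) : L y = \sum_j L (delta_mx 0 j) * y 0 j.
  rewrite {1}(row_sum_delta y).
  elim: (index_enum _) => [|j l IHl]; first by rewrite !big_nil sublinear0.
  have Lj : L (- delta_mx 0 j) = - L (delta_mx 0 j).
    by apply: Lodd; rewrite inE; apply/orP; right; apply: map_f; rewrite mem_enum.
  have Lc c : L (c *: delta_mx 0 j) = c * L (delta_mx 0 j).
    exact: sublinear_oddZ.
  rewrite !big_cons sublinear_oddD ?IHl ?Lc//; first by rewrite mulrC.
  by rewrite -scaleNr !Lc mulNr.
pose l (j : 'I_p) := L (delta_mx 0 j : V).
exists l => [y|].
  by rewrite -LE; exact: le_trans (Lle y) (tilt_le0 _ _ sq).
rewrite -LE; apply/le_anti/andP; split.
  exact: le_trans (Lle m) (tilt_le0 _ _ sq).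
have := Lodd m; rewrite inE eqxx => /(_ isT).
by have := Lle (- m); rewrite tiltN// => h e; lra.
Qed.

(** The Minkowski functional of the translate of [D] by [- v0]. *)
Definition gauge (D : set V) (v0 y : V) : R :=
  inf [set t | 0 < t /\ D (v0 + t^-1 *: y)].

Section Gauge.
Variables (D : set V) (v0 : V).
Hypotheses (oD : open D) (cD : convex_set D) (Dv0 : D v0).

(** Openness enters the separation argument through this fact: it makes the gauge finite, and
    strictly below 1 at the points of [D]. *)
Lemma open_ray (v y : V) : D v -> exists2 e : R, 0 < e & D (v + e *: y).
Proof.
move=> Dv; have : (fun e : R => v + e *: y) @ (0 : R) --> v + 0 *: y.
  by apply: cvgD; [exact: cvg_cst|apply: cvgZr_tmp; exact: cvg_id].
rewrite scale0r addr0 => /(_ D (open_nbhs_nbhs (conj oD Dv))) /nbhs_ballP[e /= e0 h].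
exists (e / 2); first by rewrite divr_gt0.
apply: (h (e / 2)); rewrite /ball /= sub0r normrN gtr0_norm ?divr_gt0//.
by rewrite ltr_pdivrMr// ltr_pMr// ltr1n.
Qed.

Lemma gauge_has_inf y : has_inf [set t | 0 < t /\ D (v0 + t^-1 *: y)].
Proof.
split; last by exists 0 => t /= [/ltW].
have [e e0 De] := open_ray y Dv0.
by exists e^-1 => /=; rewrite invr_gt0 invrK.
Qed.

Lemma gauge_le y t : 0 < t -> D (v0 + t^-1 *: y) -> gauge D v0 y <= t.
Proof. by move=> t0 Dt; apply: ge_inf => //; case: (gauge_has_inf y). Qed.

Lemma gauge_ge y c : (forall t, 0 < t -> D (v0 + t^-1 *: y) -> c <= t) ->
  c <= gauge D v0 y.
Proof.
move=> h; apply: lb_le_inf; first by case: (gauge_has_inf y).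
by move=> t [t0 Dt]; exact: h.
Qed.

Lemma gauge_sublinear : sublinear (gauge D v0).
Proof.
split=> [x y|c y c0]; last first.
  apply/le_anti/andP; split.
    rewrite -ler_pdivrMl//; apply: gauge_ge => t t0 Dt.
    rewrite ler_pdivrMl//; apply: gauge_le; first by rewrite mulr_gt0.
    by rewrite invfM scalerA mulrC mulrA mulfV ?gt_eqF// mul1r.
  apply: gauge_ge => t t0 Dt; rewrite -ler_pdivlMl//; apply: gauge_le.
    by rewrite mulr_gt0 ?invr_gt0.
  by rewrite invfM invrK mulrC -scalerA.
rewrite -lerBlDr; apply: gauge_ge => t t0 Dt; rewrite lerBlDr -lerBlDl.
apply: gauge_ge => s s0 Ds; rewrite lerBlDl.
have ts0 : 0 < t + s by rewrite addr_gt0.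
apply: gauge_le => //.
suff -> : v0 + (t + s)^-1 *: (x + y) = (t / (t + s)) *: (v0 + t^-1 *: x)
    + (1 - t / (t + s)) *: (v0 + s^-1 *: y).
  apply: convex_setP => //; first by rewrite divr_ge0// ltW.
  by rewrite ler_pdivrMr// mul1r lerDl ltW.
rewrite !scalerDr !scalerA addrACA -scalerDl.
rewrite (_ : t / (t + s) + _ = 1) ?scale1r; last by rewrite addrCA subrr addr0.
by congr (_ + (_ *: _ + _ *: _)); field; rewrite !gt_eqF.
Qed.

Lemma gauge_lt1 v : D v -> gauge D v0 (v - v0) < 1.
Proof.
move=> Dv; have [e e0 De] := open_ray (v - v0) Dv.
apply: (@le_lt_trans _ _ (1 + e)^-1).
  apply: gauge_le; first by rewrite invr_gt0 addr_gt0.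
  by rewrite invrK scalerDl scale1r addrA [v0 + _]addrC subrK.
by rewrite invf_lt1 ?ltrDl// addr_gt0.
Qed.

Lemma gauge_ge1 m : ~ D m -> 1 <= gauge D v0 (m - v0).
Proof.
move=> Dm; apply: gauge_ge => t t0 Dt; rewrite leNgt; apply/negP => t1; apply: Dm.
have -> : m = t *: (v0 + t^-1 *: (m - v0)) + (1 - t) *: v0.
  rewrite scalerDr scalerA mulfV ?gt_eqF// scale1r addrAC -scalerDl.
  by rewrite (_ : t + _ = 1) ?scale1r; [rewrite addrC subrK|rewrite addrCA subrr addr0].
by apply: convex_setP => //; exact: ltW.
Qed.

End Gauge.

(** A functional dominated by the gauge about a point [v0] of [D], and equal to it at [m - v0], is
    below 1 on [D - v0] and at least 1 at [m - v0]. *)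
Lemma open_convex_separation (D : set V) (m : V) : open D -> convex_set D ->
  ~ D m -> exists l : 'I_p -> R, forall v, D v -> \sum_j l j * (v - m) 0 j < 0.
Proof.
move=> oD cD Dm.
have [[v0 Dv0]|noD] := pselect (exists v, D v); last first.
  by exists (fun=> 0) => v Dv; case: noD; exists v.
have [l lle lm] := finite_hahn_banach (m - v0) (gauge_sublinear oD cD Dv0).
exists l => v Dv.
have -> : v - m = (v - v0) - (m - v0) by rewrite opprB addrA subrK.
under eq_bigr do rewrite !mxE mulrBr.
rewrite sumrB; have := lle (v - v0); have := gauge_lt1 oD Dv0 Dv.
have := gauge_ge1 oD cD Dv0 Dm; rewrite -lm.
under [X in 1 <= X]eq_bigr do rewrite !mxE.
under [X in _ -> _ -> X <= _ -> _]eq_bigr do rewrite !mxE.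
move=> h1 h2 h3; rewrite subr_lt0.
by apply: le_lt_trans h3 _; apply: lt_le_trans h2 h1.
Qed.

End Separation.

(** * Jensen's inequality for Lebesgue averages *)

Section Jensen.
Context {R : realType}.
Local Notation mu := (@lebesgue_measure R).

Lemma Rintegral_sum (A : set (measurableTypeR R)) (I : Type) (s : seq I) (h : I -> R -> R) :
  measurable A -> (forall i, mu.-integrable A (EFin \o h i)) ->
  mu.-integrable A (EFin \o (fun x => \sum_(i <- s) h i x)) /\
  \int[mu]_(x in A) (\sum_(i <- s) h i x) = \sum_(i <- s) \int[mu]_(x in A) h i x.
Proof.
move=> mA ih.
have is_ (l : seq I) : mu.-integrable A (EFin \o (fun x => \sum_(i <- l) h i x)).
  have := integrable_sum mA l (P := xpredT) (fun i _ => ih i).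
  by apply: eq_integrable => // x _ /=; rewrite -sumEFin.
split=> //; elim: s => [|i s IHs].
  under eq_Rintegral do rewrite big_nil.
  by rewrite big_nil Rintegral_cst// mul0r.
under eq_Rintegral do rewrite big_cons.
by rewrite big_cons RintegralD// IHs.
Qed.

Lemma integrable_cstR (A : set (measurableTypeR R)) (c : R) : measurable A -> (mu A < +oo)%E ->
  mu.-integrable A (EFin \o (fun=> c)).
Proof.
move=> mA Afin.
apply: measurable_bounded_integrable => //.
exists `|c|; split=> [|x cx y _ /=]; first exact: num_real.
exact: ltW.
Qed.

Lemma integrableZR (A : set (measurableTypeR R)) (c : R) (f : R -> R) : measurable A ->
  mu.-integrable A (EFin \o f) -> mu.-integrable A (EFin \o (fun x => c * f x)).
Proof. by move=> mA /(integrableZl mA c). Qed.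

Lemma integrableDR (A : set (measurableTypeR R)) (f g : R -> R) : measurable A ->
  mu.-integrable A (EFin \o f) -> mu.-integrable A (EFin \o g) ->
  mu.-integrable A (EFin \o (fun x => f x + g x)).
Proof. by move=> mA hf hg; have := integrableD mA hf hg. Qed.

(** A zero integral would make [f] vanish almost everywhere on [A], and so enclose [A] in a null
    set. *)
Lemma Rintegral_gt0 (A : set (measurableTypeR R)) (f : R -> R) : measurable A -> (0 < mu A)%E ->
  mu.-integrable A (EFin \o f) -> (forall x, A x -> 0 < f x) ->
  0 < \int[mu]_(x in A) f x.
Proof.
move=> mA A0 intf f0.
have If0 : 0 <= \int[mu]_(x in A) f x by apply: Rintegral_ge0 => x /f0/ltW.
rewrite lt_neqAle If0 andbT; apply/eqP => I0.
have : (\int[mu]_(x in A) `|(EFin \o f) x| = 0)%E.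
  rewrite (_ : (\int[mu]_(x in A) _)%E = (\int[mu]_(x in A) (f x)%:E)%E).
    by rewrite -[LHS]fineK ?integrable_fin_num// -[fine _]/(\int[mu]_(x in A) f x) -I0.
  by apply: eq_integral => x /set_mem Ax /=; rewrite gtr0_norm// f0.
move/(ae_eq_integral_abs mu mA (measurable_int mu intf)) => [N [mN N0 AN]].
have : (mu A <= mu N)%E.
  apply: le_measure; rewrite ?inE// => x Ax; apply: AN => /= /(_ Ax) [] fx0.
  by have := f0 x Ax; rewrite fx0 ltxx.
by rewrite N0 leNgt A0.
Qed.

Context {p : nat}.
Local Notation V := 'rV[R]_p.

Definition row_Rintegral (A : set (measurableTypeR R)) (w : R -> V) : V :=
  \row_j \int[mu]_(x in A) w x 0 j.

Variables (A : set (measurableTypeR R)) (w : R -> V).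
Hypotheses (mA : measurable A) (A0 : (0 < mu A)%E) (Afin : (mu A < +oo)%E).
Hypothesis intw : forall j, mu.-integrable A (EFin \o (fun x => w x 0 j)).

Local Notation m := (fine (mu A)).
Local Notation M := (m^-1 *: row_Rintegral A w).

Let m0 : 0 < m.
Proof. by rewrite fine_gt0// A0. Qed.

(** The linear part is centred at the mean [M] and integrates to zero. It serves with [c = 0] for
    separation and with [c = U M] for the tangent plane. *)
Lemma Rintegral_affine_mean (l : 'I_p -> R) (c : R) :
  mu.-integrable A (EFin \o (fun x => c + \sum_j l j * (w x - M) 0 j)) /\
  \int[mu]_(x in A) (c + \sum_j l j * (w x - M) 0 j) = c * m.
Proof.
have h j : mu.-integrable A (EFin \o (fun x => l j * (w x - M) 0 j)).
  apply: integrableZR => //.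
  have /(integrableDR mA (intw j)) := integrable_cstR (- M 0 j) mA Afin.
  by apply: eq_integrable => // x _; rewrite /= !mxE.
have [h1 h2] := Rintegral_sum (index_enum 'I_p) mA h.
split; first exact/integrableDR/h1/integrable_cstR.
rewrite RintegralD ?h2 //; last exact: integrable_cstR.
rewrite Rintegral_cst// big1 ?addr0// => j _.
rewrite RintegralZl//; last first.
  have /(integrableDR mA (intw j)) := integrable_cstR (- M 0 j) mA Afin.
  by apply: eq_integrable => // x _; rewrite /= !mxE.
under eq_Rintegral do rewrite !mxE.
rewrite RintegralB//; last exact: integrable_cstR.
by rewrite Rintegral_cst// mulrAC mulVf ?gt_eqF// mul1r subrr mulr0.
Qed.

(** A functional separating the mean from [D] would have one strict sign on all centred values, yet
    these average to zero. *)
Lemma open_convex_mean (D : set V) : open D -> convex_set D ->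
  (forall x, A x -> D (w x)) -> D M.
Proof.
move=> oD cD Dw; apply: contrapT => /(open_convex_separation oD cD)[l hl].
have [h1 h2] := Rintegral_affine_mean (fun j => - l j) 0.
have : 0 < \int[mu]_(x in A) (0 + \sum_j - l j * (w x - M) 0 j).
  apply: Rintegral_gt0 => // x /Dw /hl.
  by under [X in _ -> 0 < _ + X]eq_bigr do rewrite mulNr; rewrite sumrN add0r oppr_gt0.
by rewrite h2 mul0r ltxx.
Qed.

(** The convexity inequality on the segment, divided by [t] and passed to the limit; the limit is
    taken from the right because [t] ranges over []0, 1]]. *)
Lemma convex_tangent (D : set V) (U : V -> R) (v v' : V) : convex_function D U ->
  D v -> D v' -> differentiable U v -> U v + 'd U v (v' - v) <= U v'.
Proof.
move=> cU Dv Dv' dU; rewrite -lerBrDl -deriveE//.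
have : derivable U v (v' - v) by exact: diff_derivable.
move=> /cvg_ex[l hl].
rewrite /derive (cvg_lim _ hl)//.
have hl' : h^-1 *: (U (h *: (v' - v) + v) - U v) @[h --> 0^'+] --> l.
  exact: cvg_dnbhs_at_right.
apply: (cvgr_to_le hl'); near=> t.
have t0 : 0 < t by near: t; exact: nbhs_right_gt.
have t1 : t <= 1 by near: t; exact: nbhs_right_le.
rewrite /GRing.scale/= ler_pdivrMl// lerBlDr.
have -> : t *: (v' - v) + v = t *: v' + (1 - t) *: v.
  by rewrite scalerBr scalerBl scale1r -addrA [- _ + v]addrC.
apply: (le_trans (convex_functionP cU (ltW t0) t1 Dv' Dv)); lra.
Unshelve. all: by end_near. Qed.

(** Jensen's inequality: the tangent plane of [U] at the mean lies below [U] on [D], and integrates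
    to [m * U M]. *)
Lemma persp_epi_Rintegral (D : set V) (U : V -> R) : open D -> convex_set D ->
  convex_function D U -> (forall v, D v -> differentiable U v) ->
  (forall x, A x -> D (w x)) -> mu.-integrable A (EFin \o (U \o w)) ->
  persp_epi D U m (row_Rintegral A w) (\int[mu]_(x in A) U (w x)).
Proof.
move=> oD cD cU dU Dw intU; have DM := open_convex_mean oD cD Dw.
right; split=> //.
have [h1 h2] := Rintegral_affine_mean (fun j => 'd U M (delta_mx 0 j)) (U M).
rewrite mulrC -h2; apply: le_Rintegral => // x Ax.
have := convex_tangent cU DM (Dw x Ax) (dU _ DM).
rewrite [in X in X -> _](row_sum_delta (w x - M)) linear_sum.
rewrite (eq_bigr (fun j => 'd U M (delta_mx 0 j) * (w x - M) 0 j))// => j _.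
by rewrite linearZ; exact: mulrC.
Qed.

End Jensen.

(** * Lebesgue integrals on the real line *)

Section IntegralTools.
Context {R : realType}.
Local Notation mu := (@lebesgue_measure R).
Local Notation mR := (measurableTypeR R).

(** By uniqueness of Lebesgue measure: [t^-1] times the pushforward gives half-open intervals their
    length. *)
Lemma pushforward_lebesgue_scale (t : {nonneg R}) (A : set mR) :
  0 < t%:num -> measurable A ->
  pushforward mu ((fun x => x / t%:num) : mR -> mR) A = mscale t mu A.
Proof.
move=> t0 mA.
pose phi : mR -> mR := fun x => x / t%:num.
have mphi : measurable_fun setT phi by apply: measurable_funM.
have ti0 : 0 <= t%:num^-1 by rewrite invr_ge0.
have E B : measurable B -> mu B = mscale (NngNum ti0) (pushforward mu phi) B.
  move: B; apply: lebesgue_measure_unique => // _ [[a b] _ <-].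
  transitivity ((t%:num^-1)%:E * mu (phi @^-1` `]a, b]))%E; last by [].
  have -> : phi @^-1` `]a, b] = `](a * t%:num), (b * t%:num)]%classic.
    apply/seteqP; split => x /=; rewrite !in_itv /= ltr_pdivlMr// ler_pdivrMr//.
  rewrite !lebesgue_measure_itv /= !lte_fin ltr_pM2r//; case: ifP => _.
    by rewrite -!EFinD -EFinM -mulrBl mulrC mulfK ?gt_eqF.
  by rewrite mule0.
have -> : mscale t mu A = (t%:num%:E * mu A)%E by [].
have -> : mu A = ((t%:num^-1)%:E * pushforward mu phi A)%E by exact: E.
by rewrite muleA -EFinM mulfV ?gt_eqF// mul1e.
Qed.

(** Change of variables [x / t], first for nonnegative functions, then through positive and negative
    parts. *)
Lemma Rintegral_dilation (A : set mR) (f : R -> R) (t : R) : 0 < t ->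
  measurable A -> measurable_fun setT f -> mu.-integrable A (EFin \o f) ->
  let A' := (fun x => x / t) @^-1` A in
  mu.-integrable A' (EFin \o (fun x => f (x / t))) /\
  \int[mu]_(x in A') f (x / t) = t * \int[mu]_(x in A) f x.
Proof.
move=> t0 mA mf intf A'.
pose phi : mR -> mR := fun x => x / t.
have mphi : measurable_fun setT phi by apply: measurable_funM.
pose tn := NngNum (ltW t0).
have ge0E (h : R -> \bar R) : measurable_fun setT h -> (forall x, (0 <= h x)%E) ->
    (\int[mu]_(x in A') h (x / t)%R = t%:E * \int[mu]_(x in A) h x)%E.
  move=> mh h0.
  have mhA : measurable_fun A h by exact: measurable_funTS.
  have /esym := ge0_integral_pushforward mphi mu mA mhA (fun x _ => h0 x).
  move=> e; apply: (eq_trans e).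
  rewrite -(ge0_integral_mscale mu mA tn mhA)//.
  by apply: eq_measure_integral => B mB _; exact: pushforward_lebesgue_scale.
have mEf : measurable_fun setT (EFin \o f) by exact/measurable_EFinP.
have mA' : measurable A' by rewrite -[A']setTI; exact: mphi.
have intf' : mu.-integrable A' (EFin \o (fun x => f (x / t))).
  apply/integrableP; split.
    apply/measurable_EFinP; apply: measurable_funTS.
    exact: (measurableT_comp mf mphi).
  have -> : (\int[mu]_(x in A') `|(EFin \o (fun x => f (x / t)%R)) x|
      = t%:E * \int[mu]_(x in A) `|(EFin \o f) x|)%E.
    rewrite -(ge0E (fun x => `|(EFin \o f) x|%E))//; exact: measurableT_comp.
  have /integrableP[_ h] := intf.
  by rewrite lte_mul_pinfty// lee_fin ltW.
split=> //.
rewrite /Rintegral.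
have -> : (\int[mu]_(x in A') (f (x / t)%R)%:E = t%:E * \int[mu]_(x in A) (f x)%:E)%E.
  rewrite integralE [in RHS]integralE muleBr//; last first.
    exact: integrable_add_def.
  congr (_ - _)%E.
    rewrite -(ge0E ((EFin \o f)^\+)%E)//; last exact: measurable_funepos.
    by apply: eq_integral => x _; rewrite !funeposE.
  rewrite -(ge0E ((EFin \o f)^\-)%E)//; last exact: measurable_funeneg.
  by apply: eq_integral => x _; rewrite !funenegE.
by rewrite fineM// integrable_fin_num.
Qed.

Lemma integrable_setUR (A B : set mR) (f : R -> R) : measurable A -> measurable B ->
  [disjoint A & B] -> mu.-integrable A (EFin \o f) ->
  mu.-integrable B (EFin \o f) -> mu.-integrable (A `|` B) (EFin \o f).
Proof.
move=> mA mB AB iA iB; apply/integrableP; split.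
  apply/measurable_funU => //; split; [exact: measurable_int iA|exact: measurable_int iB].
have /integrableP[mfA fA] := iA; have /integrableP[mfB fB] := iB.
rewrite ge0_integral_setU//.
  by rewrite lte_add_pinfty.
by apply: measurableT_comp => //; apply/measurable_funU.
Qed.

Lemma integrable_continuous (f : R -> R) (a b : R) : continuous f ->
  mu.-integrable `[a, b] (EFin \o f).
Proof.
move=> cf; apply: continuous_compact_integrable; first exact: segment_compact.
exact: continuous_subspaceT.
Qed.

Lemma Rintegral_FTC (f F : R -> R) (a b : R) : a <= b -> continuous f ->
  (forall x : R, is_derive x (1 : R) F (f x)) -> \int[mu]_(x in `[a, b]) f x = F b - F a.
Proof.
rewrite le_eqVlt => /orP[/eqP -> _ _|ab cf dF].
  by rewrite set_itv1 Rintegral_set1 subrr.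
have cF : continuous F.
  move=> x; apply: differentiable_continuous; apply/derivable1_diffP.
  by case: (dF x).
rewrite /Rintegral (@continuous_FTC2 _ f F)//.
- exact: continuous_subspaceT.
- split=> [x _||]; first by case: (dF x).
  + exact/cvg_at_right_filter/cF.
  + exact/cvg_at_left_filter/cF.
- by move=> x _; rewrite derive1E; case: (dF x).
Qed.

Lemma Rintegral_horner (P Q : {poly R}) (a b : R) : a <= b -> Q^`() = P ->
  \int[mu]_(x in `[a, b]) P.[x] = Q.[b] - Q.[a].
Proof.
move=> ab QP; apply: Rintegral_FTC => //; first exact: continuous_horner.
by move=> x; rewrite -QP; exact: is_derive_poly.
Qed.

(** The same conditional as the initial datum in [riemann_weak_form], so that the two are
    convertible. *)
Definition step (gl gr x : R) : R := if x < 0 then gl else gr.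

Lemma Rintegral_step (gl gr c : R) (phi : R -> R) : 0 < c ->
  mu.-integrable `[- c, c] (EFin \o phi) ->
  mu.-integrable `[- c, c] (EFin \o (fun x => step gl gr x * phi x)) /\
  \int[mu]_(x in `[- c, c]) (step gl gr x * phi x) =
    gl * \int[mu]_(x in `[- c, 0]) phi x + gr * \int[mu]_(x in `[0, c]) phi x.
Proof.
move=> c0 iphi.
have cE : `[- c, c]%classic = `[- c, 0[ `|` `[0, c] :> set mR.
  by rewrite -itv_bndbnd_setU// bnd_simp ?oppr_le0 ltW.
have dis : [disjoint (`[- c, 0[%classic : set mR) & `[0, c]].
  apply/disj_setPS => x [] /=; rewrite !in_itv/= => /andP[_ x0] /andP[+ _].
  by rewrite leNgt x0.
have iL : mu.-integrable `[- c, 0[ (EFin \o phi).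
  by apply: integrableS iphi => //; rewrite cE; exact: subsetUl.
have iR : mu.-integrable `[0, c] (EFin \o phi).
  by apply: integrableS iphi => //; rewrite cE; exact: subsetUr.
have EL : {in (`[- c, 0[%classic : set mR), (fun x => gl * phi x) =1 (fun x => step gl gr x * phi x)}.
  by move=> x /set_mem; rewrite /= in_itv/= /step => /andP[_ ->].
have ER : {in (`[0, c]%classic : set mR), (fun x => gr * phi x) =1 (fun x => step gl gr x * phi x)}.
  by move=> x /set_mem; rewrite /= in_itv/= /step ltNge => /andP[->].
have isL : mu.-integrable `[- c, 0[ (EFin \o (fun x => step gl gr x * phi x)).
  by apply: eq_integrable (integrableZR gl _ iL) => // x /EL /= ->.
have isR : mu.-integrable `[0, c] (EFin \o (fun x => step gl gr x * phi x)).
  by apply: eq_integrable (integrableZR gr _ iR) => // x /ER /= ->.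
have is_ := integrable_setUR _ _ dis isL isR.
rewrite cE; split; first exact: is_.
rewrite Rintegral_setU//; last exact: is_.
rewrite -(eq_Rintegral _ EL) -(eq_Rintegral _ ER) !RintegralZl//.
by rewrite Rintegral_itv_bndo_bndc.
Qed.

End IntegralTools.

(** * The test function *)

Section Cutoff.
Context {R : realType}.

(** A C^1 spline whose derivative has a closed form; composed with itself it gives a C^1 cutoff
    falling from 1 on [y <= 0] to 0 on [y >= 1]. *)
Definition sq_pos (y : R) : R := Num.max 0 y ^+ 2.
Definition cutoff (y : R) : R := sq_pos (1 - sq_pos y).
Definition dcutoff (y : R) : R :=
  2 * Num.max 0 (1 - sq_pos y) * - (2 * Num.max 0 y).
(** For [b >= 0] the plateau is [[-b, b]] and the support lies in [[-(b+1), b+1]]. With [b = 0], the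
    time factor, the plateau shrinks to the initial time. *)
Definition bump (b x : R) : R := cutoff (x - b) * cutoff (- x - b).
Definition dbump (b x : R) : R :=
  dcutoff (x - b) * cutoff (- x - b) - cutoff (x - b) * dcutoff (- x - b).

(** A quadratic remainder bound uniform in [y], which gives the derivative at the kink [0] and
    elsewhere alike. *)
Lemma sq_pos_remainder (y h : R) :
  `|sq_pos (h + y) - sq_pos y - 2 * Num.max 0 y * h| <= h ^+ 2.
Proof.
rewrite /sq_pos ler_norml.
by case: (leP 0 y) => ?; case: (leP 0 (h + y)) => ?; apply/andP; split; nra.
Qed.

Lemma is_derive_sq_pos (y : R) : is_derive y (1 : R) sq_pos (2 * Num.max 0 y).
Proof.
have H : h^-1 *: (sq_pos (h *: (1 : R) + y) - sq_pos y) @[h --> (0 : R)^']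
    --> 2 * Num.max 0 y.
  apply/cvgrPdist_le => e e0; near=> h.
  have h0 : h != 0 by near: h; exact: nbhs_dnbhs_neq.
  have hn : 0 < `|h| by rewrite normr_gt0.
  rewrite [h *: 1]mulr1.
  have -> : 2 * Num.max 0 y - h^-1 *: (sq_pos (h + y) - sq_pos y)
      = - (h^-1 * (sq_pos (h + y) - sq_pos y - 2 * Num.max 0 y * h)).
    rewrite -[h^-1 *: _]/(h^-1 * (sq_pos (h + y) - sq_pos y)).
    by move: (sq_pos _ - _) (Num.max _ _) => d M; field.
  rewrite normrN normrM normfV ler_pdivrMl//.
  apply: le_trans (sq_pos_remainder y h) _.
  rewrite -real_normK ?num_real// expr2 ler_pM2l//.
  near: h; apply: dnbhs0_le => //.
apply: DeriveDef; first exact: (cvgP _ H).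
exact: cvg_lim H.
Unshelve. all: by end_near. Qed.

Lemma continuous_max0 : continuous (fun y : R => Num.max 0 y).
Proof. by move=> x; apply: (@continuous_max _ _ (cst 0) id) => //; exact: cvg_cst. Qed.

Lemma continuous_sq_pos : continuous sq_pos.
Proof.
move=> x; apply: (@continuous_comp _ _ _ (fun y : R => Num.max 0 y) (fun z => z ^+ 2)).
  exact: continuous_max0.
exact: exprn_continuous.
Qed.

Lemma is_derive_cutoff (y : R) : is_derive y (1 : R) cutoff (dcutoff y).
Proof.
have d1 : is_derive y (1 : R) (cst 1 - sq_pos) (- (2 * Num.max 0 y)).
  have := is_deriveB (is_derive_cst (1 : R) y (1 : R)) (is_derive_sq_pos y).
  by rewrite sub0r.
exact: (is_derive1_comp (is_derive_sq_pos _) d1).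
Qed.

Lemma continuous_cutoff : continuous cutoff.
Proof.
move=> y; have [/derivable1_diffP/differentiable_continuous//] := is_derive_cutoff y.
Qed.

Lemma continuous_dcutoff : continuous dcutoff.
Proof.
move=> y; apply: cvgM; [apply: cvgMl_tmp|apply: cvgN; apply: cvgMl_tmp; exact: continuous_max0].
apply: (@continuous_comp _ _ _ (fun y => 1 - sq_pos y) (fun y => Num.max 0 y)).
  by apply: cvgB; [exact: cvg_cst|exact: continuous_sq_pos].
exact: continuous_max0.
Qed.

Lemma cutoff_le0 y : y <= 0 -> cutoff y = 1.
Proof.
move=> y0; rewrite /cutoff /sq_pos (max_l y0) expr0n/= subr0 max_r//.
by rewrite expr1n.
Qed.

Lemma dcutoff_le0 y : y <= 0 -> dcutoff y = 0.
Proof. by move=> y0; rewrite /dcutoff (max_l y0) mulr0 oppr0 mulr0. Qed.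

Let sq_pos_ge1 y : 1 <= y -> 1 - sq_pos y <= 0.
Proof.
move=> y1; rewrite /sq_pos max_r; last exact: le_trans y1.
by rewrite subr_le0 exprn_ege1.
Qed.

Lemma cutoff_ge1 y : 1 <= y -> cutoff y = 0.
Proof. by move=> /sq_pos_ge1 h; rewrite /cutoff {1}/sq_pos max_l// expr0n. Qed.

Lemma dcutoff_ge1 y : 1 <= y -> dcutoff y = 0.
Proof. by move=> /sq_pos_ge1 h; rewrite /dcutoff max_l// mulr0 mul0r. Qed.

Lemma cutoff_ge0 y : 0 <= cutoff y.
Proof. exact: sqr_ge0. Qed.

Lemma cutoff_gt0 y : y < 1 -> 0 < cutoff y.
Proof.
move=> y1; rewrite /cutoff {1}/sq_pos exprn_gt0// lt_max subr_gt0 /sq_pos.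
apply/orP; right; case: (leP 0 y) => y0; last by rewrite expr0n.
by rewrite exprn_ilt1.
Qed.

Lemma is_derive_bump (b x : R) : is_derive x (1 : R) (bump b) (dbump b x).
Proof.
have d1 : is_derive x (1 : R) (id - cst b) 1.
  by have := is_deriveB (is_derive_id x (1 : R)) (is_derive_cst b x (1 : R)); rewrite subr0.
have d2 : is_derive x (1 : R) (- id - cst b) (-1).
  have := is_deriveB (is_deriveN (is_derive_id x (1 : R))) (is_derive_cst b x (1 : R)).
  by rewrite subr0.
have c1 := @is_derive1_comp _ cutoff (id - cst b) x _ _ (is_derive_cutoff (x - b)) d1.
have c2 := @is_derive1_comp _ cutoff (- id - cst b) x _ _ (is_derive_cutoff (- x - b)) d2.
apply: is_derive_eq (is_deriveM c1 c2) _.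
rewrite /dbump /= /GRing.scale /=; ring.
Qed.

Lemma continuous_bump b : continuous (bump b).
Proof.
move=> y; have [/derivable1_diffP/differentiable_continuous//] := is_derive_bump b y.
Qed.

Lemma continuous_dbump b : continuous (dbump b).
Proof.
move=> y.
have h1 : (fun x : R => x - b) @ y --> y - b by apply: cvgB; [exact: cvg_id|exact: cvg_cst].
have h2 : (fun x : R => - x - b) @ y --> - y - b.
  by apply: cvgB; [apply: cvgN; exact: cvg_id|exact: cvg_cst].
by apply: cvgB; apply: cvgM; apply: continuous_cvg => //;
  do ?[exact: continuous_cutoff|exact: continuous_dcutoff].
Qed.

Lemma bump_ge0 b x : 0 <= bump b x.
Proof. by rewrite mulr_ge0// cutoff_ge0. Qed.

Lemma bump_in b x : `|x| <= b -> bump b x = 1 /\ dbump b x = 0.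
Proof.
rewrite ler_norml => /andP[h1 h2]; rewrite /bump /dbump.
by rewrite !cutoff_le0 ?dcutoff_le0 ?mulr1 ?mulr0 ?mul0r ?subr0//; lra.
Qed.

Lemma bump_out b x : 0 <= b -> b + 1 <= `|x| -> bump b x = 0 /\ dbump b x = 0.
Proof.
move=> b0; rewrite ler_normr /bump /dbump => /orP[h|h].
  by rewrite (@cutoff_ge1 (x - b)) ?(@dcutoff_ge1 (x - b)) ?mul0r ?subr0//; lra.
by rewrite (@cutoff_ge1 (- x - b)) ?(@dcutoff_ge1 (- x - b)) ?mulr0 ?subr0//; lra.
Qed.

Lemma bump0_gt0 t : 0 <= t -> t < 1 -> 0 < bump 0 t.
Proof.
by move=> t0 t1; rewrite mulr_gt0 ?cutoff_gt0//; lra.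
Qed.

Definition riemann_test (b : R) (z : R * R) : R := bump b z.1 * bump 0 z.2.

Lemma riemann_test_diff b (z : R * R) : differentiable (riemann_test b) z /\
  forall v, 'd (riemann_test b) z v =
    v.1 * (dbump b z.1 * bump 0 z.2) + v.2 * (bump b z.1 * dbump 0 z.2).
Proof.
have d1 c x : is_diff x (bump c) (fun h : R => h * dbump c x).
  have dc := is_derive_bump c x; have dd : derivable (bump c) x (1 : R) by [].
  apply: DiffDef; first exact/derivable1_diffP.
  by rewrite deriv1E// derive1E derive_val.
have dfst : is_diff z (fst : R * R -> R) fst.
  have cf : continuous (fst : R * R -> R) by move=> ?; exact: cvg_fst.
  by apply: DiffDef; [exact: linear_differentiable|rewrite diff_lin].
have dsnd : is_diff z (snd : R * R -> R) snd.
  have cf : continuous (snd : R * R -> R) by move=> ?; exact: cvg_snd.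
  by apply: DiffDef; [exact: linear_differentiable|rewrite diff_lin].
have H := is_diffM (is_diff_comp dfst (d1 b z.1)) (is_diff_comp dsnd (d1 0 z.2)).
split; first exact: (@ex_diff _ _ _ _ _ _ _ H).
move=> v; have -> : 'd (riemann_test b) z = 'd ((bump b \o fst) * (bump 0 \o snd)) z by [].
rewrite diff_val !fctE /=.
transitivity (bump b z.1 * (v.2 * dbump 0 z.2) + bump 0 z.2 * (v.1 * dbump b z.1)).
  by [].
by ring.
Qed.

Lemma riemann_test_function b : 0 <= b -> test_function (riemann_test b).
Proof.
move=> b0; split.
  move=> z _; split; first by case: (riemann_test_diff b z).
  move=> v.
  have -> : (fun y => 'd (riemann_test b) y v) = (fun z : R * R =>
      v.1 * (dbump b z.1 * bump 0 z.2) + v.2 * (bump b z.1 * dbump 0 z.2)).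
    by apply/funext => y; case: (riemann_test_diff b y).
  have c1 (f : R -> R) : continuous f -> (f \o fst) @ z --> f z.1.
    by move=> cf; apply: continuous_cvg; [exact: cf|exact: cvg_fst].
  have c2 (f : R -> R) : continuous f -> (f \o snd) @ z --> f z.2.
    by move=> cf; apply: continuous_cvg; [exact: cf|exact: cvg_snd].
  apply: cvgD; apply: cvgMl_tmp; apply: cvgM.
  - exact/c1/continuous_dbump.
  - exact/c2/continuous_bump.
  - exact/c1/continuous_bump.
  - exact/c2/continuous_dbump.
exists (b + 1) => z; rewrite prod_normE lt_max /riemann_test => /orP[h|h].
  by rewrite (bump_out b0 (ltW h)).1 mul0r.
by rewrite (bump_out (lexx 0) (x := z.2) _).1 ?mulr0// add0r; apply: le_trans (ltW h); lra.
Qed.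

End Cutoff.

(** * Balance laws over the Riemann fan *)

Section WeakForm.
Context {R : realType}.
Local Notation mu := (@lebesgue_measure R).
Local Notation mR := (measurableTypeR R).

Lemma locally_integrable_itv (f : R -> R) (a b : R) : locally_integrable setT f ->
  mu.-integrable `[a, b] (EFin \o f).
Proof.
move=> [mf _ ifo]; apply/integrableP; split.
  by apply/measurable_EFinP; exact: measurable_funTS.
exact/ifo/segment_compact.
Qed.

Lemma Rintegral_support (A B : set mR) (f : R -> R) : A `<=` B ->
  (forall x, B x -> ~ A x -> f x = 0) ->
  \int[mu]_(x in B) f x = \int[mu]_(x in A) f x.
Proof.
move=> AB f0; rewrite [LHS]Rintegral_mkcond [RHS]Rintegral_mkcond.
congr Rintegral; apply/funext => x; rewrite !patchE.
have [/set_mem xA|/negP xA] := boolP (x \in A).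
  by rewrite mem_set//; exact: AB.
have nA : ~ A x by move=> Ax; apply: xA; rewrite inE.
by case: ifPn => // /set_mem Bx; exact: f0.
Qed.

Lemma Rintegral_cst_itv (r a b : R) : a <= b ->
  \int[mu]_(x in `[a, b]) r = r * (b - a).
Proof.
move=> ab; rewrite Rintegral_cst; last exact: measurable_itv.
congr (_ * _); rewrite [X in fine X](lebesgue_measure_itv `[a, b]) /= lte_fin.
by case: ltP => //= ba; rewrite (@le_anti _ _ a b) ?subrr// ab.
Qed.

Lemma stepN (gl gr x : R) : x < 0 -> step gl gr x = gl.
Proof. by rewrite /step => ->. Qed.

Lemma stepP (gl gr x : R) : 0 <= x -> step gl gr x = gr.
Proof. by rewrite /step leNgt => /negbTE ->. Qed.

(** A self-similar profile with waves of speed at most [b]: a component of the Riemann solution or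
    of its flux, or an entropy or entropy flux along it. *)
Definition fan (b gl gr : R) (g : R -> R) :=
  locally_integrable setT g /\
  forall x, (x < - b -> g x = gl) /\ (b < x -> g x = gr).

Lemma fan_step b gl gr g t x : 0 < b -> 0 < t -> fan b gl gr g ->
  ~ `[- (b * t), b * t]%classic x -> g (x / t) = step gl gr x.
Proof.
move=> b0 t0 [_ gE] /=; rewrite in_itv /= => /negP; rewrite negb_and -!ltNge.
have bt0 : 0 < b * t by rewrite mulr_gt0.
move=> /orP[h|h].
  rewrite stepN ?(gE _).1//; last by apply: lt_trans h _; rewrite oppr_lt0.
  by rewrite ltr_pdivrMr// mulNr.
rewrite stepP ?(gE _).2//; last by apply: ltW; exact: lt_trans h.
by rewrite ltr_pdivlMr.
Qed.

(** Mass of the profile over the fan at time 1, minus the mass of the initial step over the same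
    interval. The balance law equates it with minus the flux difference. *)
Definition fan_excess (b gl gr : R) (g : R -> R) : R :=
  \int[mu]_(x in `[- b, b]) g x - b * (gl + gr).

(** At time [t] the fan is [[-bt, bt]]; by self-similarity the deviation from the initial datum
    grows linearly in [t]. *)
Lemma Rintegral_fan_slice b gl gr g t : 0 < b -> 0 < t -> fan b gl gr g ->
  let e := (fun x => g (x / t) - step gl gr x) in
  mu.-integrable `[- (b * t), b * t] (EFin \o e) /\
  \int[mu]_(x in `[- (b * t), b * t]) e x = t * fan_excess b gl gr g.
Proof.
move=> b0 t0 [lg gE] e.
have bt0 : 0 < b * t by rewrite mulr_gt0.
have [mg _ _] := lg.
have := Rintegral_dilation t0 (measurable_itv `[- b, b]) mg (locally_integrable_itv (- b) b lg).
have -> : (fun x : R => x / t) @^-1` `[- b, b] = `[- (b * t), b * t]%classic.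
  by apply/seteqP; split => x /=; rewrite !in_itv /= ler_pdivlMr// ler_pdivrMr// mulNr.
move=> /= [i1 e1].
have := Rintegral_step gl gr bt0 (integrable_cstR (1 : R) (measurable_itv `[- (b * t), b * t]) _).
rewrite lebesgue_measure_itv /= lte_fin gt0_cp// -EFinB ltry => /(_ isT)[i2 e2].
have i3 : mu.-integrable `[- (b * t), b * t] (EFin \o step gl gr).
  by apply: eq_integrable i2 => // x _ /=; rewrite mulr1.
have e3 : \int[mu]_(x in `[- (b * t), b * t]) step gl gr x = (gl + gr) * (b * t).
  transitivity (\int[mu]_(x in `[- (b * t), b * t]) (step gl gr x * 1)).
    by apply: eq_Rintegral => x _; rewrite mulr1.
  rewrite e2 !Rintegral_cst_itv ?oppr_le0 ?(ltW bt0)//.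
  by rewrite sub0r opprK subr0 !mul1r mulrDl.
have /= i4 := integrableZR (-1) (measurable_itv _) i3.
split.
  apply: eq_integrable (integrableDR (measurable_itv _) i1 i4) => // x _ /=.
  by rewrite mulN1r.
rewrite RintegralB// e1 e3 /fan_excess; ring.
Qed.

(** For [t < 1] the fan lies in the plateau of [bump b]. Hence [g] contributes its initial mass plus
    the excess at time [t], while [h] is only seen outside the fan, where it equals its step. *)
Lemma riemann_inner_integral (b gl gr : R) g (hl hr : R) h (t : R) : 0 < b -> 0 < t -> t < 1 ->
  fan b gl gr g -> fan b hl hr h ->
  \int[mu]_x (g (x / t) * 'd (riemann_test b) (x, t) (0, 1) +
              h (x / t) * 'd (riemann_test b) (x, t) (1, 0)) =
  dbump 0 t * (\int[mu]_x (step gl gr x * riemann_test b (x, 0))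
               + t * fan_excess b gl gr g)
  + bump 0 t * (hl - hr).
Proof.
move=> b0 t0 t1 fg fh.
have c0 : 0 < b + 1 by rewrite addr_gt0.
have vanish x : ~ `[- (b + 1), b + 1]%classic x -> bump b x = 0 /\ dbump b x = 0.
  move=> /= /negP; rewrite in_itv /= -ler_norml -ltNge => /ltW.
  exact/bump_out/ltW.
have btb : b * t <= b by rewrite ger_pMr// ltW.
rewrite (@Rintegral_support `[- (b + 1), b + 1]%classic setT)//; last first.
  move=> x _ /vanish [z1 z2]; rewrite !(riemann_test_diff b (x, t)).2 /= z1 z2.
  by rewrite !(mul0r, mulr0, addr0).
rewrite [in RHS](@Rintegral_support `[- (b + 1), b + 1]%classic setT)//; last first.
  by move=> x _ /vanish [z1 _]; rewrite /riemann_test /= z1 mul0r mulr0.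
have B0 : bump (0 : R) 0 = 1 by apply: (bump_in _).1; rewrite normr0.
under [in RHS]eq_Rintegral do rewrite /riemann_test /= B0 mulr1.
have [i1 e1] := Rintegral_step gl gr c0 (integrable_continuous _ _ (@continuous_bump R b)).
have [i2 e2] := Rintegral_step hl hr c0 (integrable_continuous _ _ (@continuous_dbump R b)).
have [i3 e3] := Rintegral_fan_slice b0 t0 fg.
pose S : set mR := `[- (b + 1), b + 1]%classic.
pose B : set mR := `[- (b * t), b * t]%classic.
rewrite -[`[- (b + 1), b + 1]%classic]/S in i1 e1 i2 e2 *.
rewrite -[`[- (b * t), b * t]%classic]/B in i3 e3.
pose e : mR -> R := fun x => g (x / t) - step gl gr x.
rewrite -[fun x => g (x / t) - _]/e in i3 e3.
have BS : B `<=` S.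
  by move=> x; rewrite /B /S /= !in_itv /= => /andP[? ?]; apply/andP; split; lra.
have mS : measurable S by exact: measurable_itv.
have mB : measurable B by exact: measurable_itv.
have i4 : mu.-integrable S (EFin \o (e \_ B)).
  apply: (@integrableS _ _ _ mu setT) => //.
  have := (integrable_mkcond (EFin \o e) mB).1 i3.
  by apply: eq_integrable => // x _; rewrite restrict_EFin.
have e4 : \int[mu]_(x in S) (e \_ B) x = t * fan_excess b gl gr g.
  by rewrite -e3 -Rintegral_mkcondr (setIidr BS).
(* On [B] the spatial cutoff is 1 with zero derivative, so [h] may be replaced by its step there;
   outside [B] both profiles are already steps. *)
transitivity (\int[mu]_(x in S) (dbump 0 t * (step gl gr x * bump b x)
    + bump 0 t * (step hl hr x * dbump b x) + dbump 0 t * (e \_ B) x)).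
  apply: eq_Rintegral => x _; rewrite !(riemann_test_diff b (x, t)).2 /=.
  rewrite patchE; have [xB|xB] := boolP (x \in B).
    have /bump_in[-> ->] : `|x| <= b.
      move: xB => /set_mem; rewrite /B /= in_itv /= => /andP[? ?].
      by rewrite ler_norml; apply/andP; split; lra.
    rewrite /e; ring.
  have nB : ~ B x by apply/negP; rewrite notin_setE in xB; apply/negP.
  rewrite (fan_step b0 t0 fg nB) (fan_step b0 t0 fh nB) -[point]/(0 : R); ring.
have j1 := integrableZR (dbump 0 t) mS i1.
have j2 := integrableZR (bump 0 t) mS i2.
have j4 := integrableZR (dbump 0 t) mS i4.
rewrite RintegralD//; last exact: integrableDR.
rewrite RintegralD// !RintegralZl// e4 e2.
have b1 : bump b (b + 1) = 0.
  by apply: (bump_out (ltW b0) _).1; rewrite gtr0_norm.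
have bN1 : bump b (- (b + 1)) = 0.
  by apply: (bump_out (ltW b0) _).1; rewrite normrN gtr0_norm.
have bb0 : bump b 0 = 1 by apply: (bump_in _).1; rewrite normr0 ltW.
(* The derivative of the cutoff integrates to 1 on the left half and to -1 on the right half, whence
   [hl - hr]. *)
have ftc c d cd := @Rintegral_FTC R _ _ c d cd (@continuous_dbump R b) (is_derive_bump b).
rewrite !ftc ?oppr_le0 ?(ltW c0)//.
rewrite b1 bN1 bb0; ring.
Qed.

Lemma Rintegral_itvoo (f : R -> R) (a b : R) : mu.-integrable `[a, b] (EFin \o f) ->
  \int[mu]_(x in `]a, b[) f x = \int[mu]_(x in `[a, b]) f x.
Proof.
move=> i; rewrite Rintegral_itv_bndo_bndc; last first.
  by apply: integrableS i => //; apply: subset_itv; rewrite bnd_simp.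
rewrite Rintegral_itv_obnd_cbnd//.
by apply: integrableS i => //; apply: subset_itv; rewrite bnd_simp.
Qed.

Definition bump_mass : R := \int[mu]_(t in `]0, 1[) bump 0 t.

Lemma bump_mass_gt0 : 0 < bump_mass.
Proof.
apply: Rintegral_gt0 => //.
- by rewrite lebesgue_measure_itv /= lte_fin ltr01 -EFinB lte_fin subr0.
- apply: integrableS (integrable_continuous 0 1 (@continuous_bump R 0)) => //.
  by apply: subset_itv; rewrite bnd_simp.
- by move=> x /=; rewrite in_itv /= => /andP[/ltW]; exact: bump0_gt0.
Qed.

Lemma riemann_weak_form_test b gl gr g hl hr h : 0 < b ->
  fan b gl gr g -> fan b hl hr h ->
  riemann_weak_form g h gl gr (riemann_test b) =
  - (fan_excess b gl gr g + (hr - hl)) * bump_mass.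
Proof.
move=> b0 fg fh; rewrite /riemann_weak_form.
rewrite -[X in _ + X]/(\int[mu]_x (step gl gr x * riemann_test b (x, 0))).
set G0 := \int[mu]_x (step gl gr x * _); set K := fan_excess b gl gr g.
rewrite (@Rintegral_support `]0, 1[%classic); first last.
- move=> t /=; rewrite !in_itv /= andbT => t0; rewrite t0 /= => /negP; rewrite -leNgt => t1.
  have [z1 z2] : bump 0 t = 0 /\ dbump 0 t = 0.
    by apply: bump_out => //; rewrite add0r; apply: le_trans (ler_norm _).
  transitivity (\int[mu]_x (0 : R)); last by rewrite Rintegral_cst// mul0r.
  apply: eq_Rintegral => x _.
  by rewrite !(riemann_test_diff b (x, t)).2 /= z1 z2 !mulr0 addr0 !mulr0 addr0.
- by move=> t /=; rewrite !in_itv /= => /andP[->].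
(* Integration by parts in time: [Phi] falls from [G0] at 0 to 0 at 1, which cancels the
   initial-data term [G0] and leaves only multiples of [bump_mass]. *)
pose Phi : R -> R := bump 0 * (cst G0 + K \*: id).
pose phi t : R := bump 0 t * K + (G0 + K * t) * dbump 0 t.
have dPhi (t : R) : is_derive t (1 : R) Phi (phi t).
  have d2 := is_deriveD (is_derive_cst G0 t (1 : R)) (is_deriveZ K (is_derive_id t (1 : R))).
  apply: is_derive_eq (is_deriveM (is_derive_bump 0 t) d2) _.
  by rewrite add0r [K *: 1]mulr1.
have cphi : continuous phi.
  move=> t; apply: cvgD.
    by apply: cvgMr_tmp; exact: continuous_bump.
  apply: cvgM; last exact: continuous_dbump.
  by apply: cvgD; [exact: cvg_cst|apply: cvgMl_tmp; exact: cvg_id].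
transitivity (\int[mu]_(t in `]0, 1[) (phi t + (hl - hr - K) * bump 0 t) + G0).
  congr (_ + _); apply: eq_Rintegral => t /set_mem /=; rewrite in_itv /= => /andP[t0 t1].
  rewrite (riemann_inner_integral b0 t0 t1 fg fh) -/G0 -/K /phi; ring.
have sub : `]0, 1[ `<=` (`[0, 1] : set R) by apply: subset_itv; rewrite bnd_simp.
have iphi := integrable_continuous 0 1 cphi.
have ib := integrable_continuous 0 1 (@continuous_bump R 0).
have ib' : mu.-integrable `]0, 1[ (EFin \o bump 0) by apply: integrableS ib.
rewrite RintegralD//; last 2 first.
- by apply: integrableS iphi.
- exact: integrableZR.
rewrite RintegralZl// -/bump_mass Rintegral_itvoo//.
rewrite (Rintegral_FTC ler01 cphi dPhi).
have p1 : Phi 1 = 0.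
  by rewrite /Phi fctE (bump_out (lexx 0) (x := 1) _).1 ?mul0r// add0r normr1.
have p0 : Phi 0 = G0.
  rewrite /Phi !fctE /= (bump_in (b := 0) (x := 0) _).1 ?normr0// mul1r.
  by rewrite scaler0 addr0.
rewrite p1 p0; ring.
Qed.

End WeakForm.

(** * The Lax-Friedrichs flux *)

Section LaxFriedrichs.
Context {R : realType} {p : nat}.
Local Notation state := 'rV[R]_p.
Local Notation mu := (@lebesgue_measure R).

(** Finite speed makes the set under the supremum nonempty, so when it is bounded above some element
    exceeds [x]. *)
Lemma wave_speed_left (ul : state) (w : R -> state) (a r x : R) :
  (forall xi, xi < - r -> w xi = ul) -> `|min_wave_speed ul w| <= a ->
  x < - a -> w x = ul.
Proof.
move=> hr; rewrite ler_norml => /andP[ha _] xa; rewrite /min_wave_speed in ha.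
set S := [set s | _] in ha.
have S0 : S !=set0 by exists (- r).
have [[M ub]|nub] := pselect (has_ubound S).
  have [s Ss] := sup_gt S0 (lt_le_trans xa ha).
  by move=> xs; exact: Ss.
(* For an unbounded set [sup] takes a default value, but then [w] equals [ul] everywhere. *)
apply: contrapT => wx; apply: nub; exists x => s Ss.
by rewrite leNgt; apply/negP => xs; apply: wx; exact: Ss.
Qed.

Lemma wave_speed_right (ur : state) (w : R -> state) (a r x : R) :
  (forall xi, r < xi -> w xi = ur) -> `|max_wave_speed ur w| <= a ->
  a < x -> w x = ur.
Proof.
move=> hr; rewrite ler_norml => /andP[_ ha] xa; rewrite /max_wave_speed in ha.
set S := [set s | _] in ha.
have S0 : S !=set0 by exists r.
have [[M lb]|nlb] := pselect (has_lbound S).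
  have [s Ss] := inf_lt S0 (le_lt_trans ha xa).
  by move=> xs; exact: Ss.
apply: contrapT => wx; apply: nlb; exists x => s Ss.
by rewrite leNgt; apply/negP => xs; apply: wx; exact: Ss.
Qed.

(** For a fan reduced to the point 0, the profile is the initial step up to a null set. This is the
    degenerate case of zero speed bound. *)
Lemma fan_excess_stationary (gl gr : R) (g : R -> R) : locally_integrable setT g ->
  (forall x, (x < 0 -> g x = gl) /\ (0 < x -> g x = gr)) ->
  fan_excess 1 gl gr g = 0.
Proof.
move=> lg gE; have ig := locally_integrable_itv (-1) 1 lg.
have E : `[- 1, 1]%classic = `[- 1, 0[ `|` `[0, 1] :> set (measurableTypeR R).
  by rewrite -itv_bndbnd_setU// bnd_simp ?oppr_le0.
have iL : mu.-integrable `[-1, 0[ (EFin \o g).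
  by apply: integrableS ig => //; rewrite E; exact: subsetUl.
have iR : mu.-integrable `[0, 1] (EFin \o g).
  by apply: integrableS ig => //; rewrite E; exact: subsetUr.
have i0 : mu.-integrable `]0, 1] (EFin \o g).
  by apply: integrableS iR => //; apply: subset_itv; rewrite bnd_simp.
have c a b c' : mu.-integrable `[a, b] (EFin \o (fun=> c')).
  by apply: integrable_continuous => x; exact: cvg_cst.
rewrite /fan_excess E Rintegral_setU//; first last.
- apply/disj_setPS => x [] /=; rewrite !in_itv/= => /andP[_ x0] /andP[+ _].
  by rewrite leNgt x0.
- by rewrite -E.
rewrite -(Rintegral_itv_obnd_cbnd i0).
have -> : \int[mu]_(x in `[-1, 0[) g x = \int[mu]_(x in `[-1, 0[) gl.
  by apply: eq_Rintegral => x /set_mem /=; rewrite in_itv /= => /andP[_ /(gE x).1].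
have -> : \int[mu]_(x in `]0, 1]) g x = \int[mu]_(x in `]0, 1]) gr.
  by apply: eq_Rintegral => x /set_mem /=; rewrite in_itv /= => /andP[/(gE x).2].
rewrite Rintegral_itv_bndo_bndc; last first.
  by apply: integrableS (c (-1) 0 gl) => //; apply: subset_itv; rewrite bnd_simp.
rewrite Rintegral_itv_obnd_cbnd; last first.
  by apply: integrableS (c 0 1 gr) => //; apply: subset_itv; rewrite bnd_simp.
rewrite !Rintegral_cst_itv ?oppr_le0//; ring.
Qed.

Variables (D : set state) (f : state -> state) (U F : state -> R).
Hypotheses (oD : open D) (cD : convex_set D) (EP : entropy_pair D f U F).

(* For [a > 0] the middle component is [a] times the average of the Riemann
   solution over the fan [-a, a]. *)
Lemma lf_persp_epi (ul ur : state) (a : R) :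
  riemann_speed_bound D f U F ul ur a ->
  0 <= a /\ persp_epi D U a ((a / 2) *: (ul + ur) - 2^-1 *: (f ur - f ul))
    ((a / 2) * (U ul + U ur) - 2^-1 * (F ur - F ul)).
Proof.
move=> [w [Dw [r [wl wr]] wint eint wweak went]].
rewrite ge_max => /andP[minw maxw].
have a0 : 0 <= a by apply: le_trans minw.
split=> //.
have left_ x : x < - a -> w x = ul by exact: wave_speed_left wl minw.
have right_ x : a < x -> w x = ur by exact: wave_speed_right wr maxw.
have [cU C2U dF] := EP.
(* All [b >= a] are covered, since testing the weak form needs [b > 0] while [a] may be 0. *)
have fanw b (G : state -> R) : a <= b -> locally_integrable setT (G \o w) ->
    fan b (G ul) (G ur) (G \o w).
  move=> ab lG; split=> // x; split=> xb /=.
    by rewrite left_//; apply: lt_le_trans xb _; rewrite lerN2.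
  by rewrite right_//; apply: le_lt_trans xb.
have weak b j : 0 < b -> a <= b ->
    fan_excess b (ul 0 j) (ur 0 j) (fun x => w x 0 j) + (f ur 0 j - f ul 0 j) = 0.
  move=> b0 ab; have [l1 l2] := wint j.
  have := wweak _ (riemann_test_function (ltW b0)) j.
  rewrite (riemann_weak_form_test b0 (fanw b (fun u => u 0 j) ab l1)
     (fanw b (fun u => f u 0 j) ab l2)) => /eqP.
  by rewrite mulf_eq0 oppr_eq0 (gt_eqF bump_mass_gt0) orbF => /eqP.
have entr b : 0 < b -> a <= b ->
    fan_excess b (U ul) (U ur) (U \o w) + (F ur - F ul) <= 0.
  move=> b0 ab; have [l1 l2] := eint.
  have := went _ (riemann_test_function (ltW b0)).
  rewrite (riemann_weak_form_test b0 (fanw b U ab l1) (fanw b F ab l2)).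
  rewrite pmulr_lge0 ?bump_mass_gt0// oppr_ge0; apply=> z.
  by rewrite mulr_ge0// bump_ge0.
(* For [a = 0] the balances over [[-1, 1]] reduce to [f ur = f ul] and [F ur <= F ul], which is
   membership in the vertical ray. *)
move: a0; rewrite le_eqVlt => /orP[/eqP a0|a0].
  left; rewrite -a0 mul0r scale0r sub0r mul0r sub0r.
  have st (G : state -> R) : locally_integrable setT (G \o w) ->
      fan_excess 1 (G ul) (G ur) (G \o w) = 0.
    move=> lG; apply: fan_excess_stationary => // x; split=> x0 /=.
      by rewrite left_// -a0 oppr0.
    by rewrite right_// -a0.
  have a1 : a <= 1 by rewrite -a0.
  split=> //.
    apply/rowP => j; rewrite !mxE.
    have := weak 1 j ltr01 a1; rewrite (st (fun u => u 0 j)); last by have [] := wint j.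
    by rewrite add0r => ->; rewrite mulr0 oppr0.
  have := entr 1 ltr01 a1; rewrite st; last by have [] := eint.
  by rewrite add0r oppr_ge0 => h; rewrite pmulr_rle0// invr_gt0.
pose A : set (measurableTypeR R) := `[- a, a]%classic.
have mA : mu A = (2 * a)%:E.
  rewrite (lebesgue_measure_itv `[- a, a]) /= lte_fin gt0_cp//= -EFinB.
  by congr EFin; ring.
have A0 : (0 < mu A)%E by rewrite mA lte_fin mulr_gt0.
have Afin : (mu A < +oo)%E by rewrite mA ltry.
have intw j : mu.-integrable A (EFin \o (fun x => w x 0 j)).
  by apply: locally_integrable_itv; have [] := wint j.
have intU : mu.-integrable A (EFin \o (U \o w)).
  by apply: locally_integrable_itv; have [] := eint.
have dU v : D v -> differentiable U v by move=> /C2U[].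
have := persp_epi_Rintegral (measurable_itv `[- a, a]) A0 Afin intw oD cD cU dU
  (fun x _ => Dw x) intU.
(* The fan has length [2 * a]; halving gives weight [a], and the weak balance then identifies the
   integral with the intermediate state. *)
rewrite mA /= => /(@persp_epiZ _ _ _ _ 2^-1 _ _ _ ltac:(by rewrite invr_ge0)).
rewrite mulrA mulVf ?pnatr_eq0// mul1r => H.
have -> : (a / 2) *: (ul + ur) - 2^-1 *: (f ur - f ul) =
    2^-1 *: row_Rintegral `[- a, a] w.
  apply/rowP => j; rewrite !mxE.
  have := weak a j a0 (lexx a); rewrite /fan_excess => h.
  have -> : \int[mu]_(x in `[- a, a]) w x 0 j =
    a * (ul 0 j + ur 0 j) - (f ur 0 j - f ul 0 j) by lra.
  by ring.
apply: persp_epi_le H _.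
have h : \int[mu]_(x in A) U (w x) - a * (U ul + U ur) + (F ur - F ul) <= 0.
  exact: entr.
lra.
Qed.

(** A three-point Lax-Friedrichs update is a conic combination of [v] and the two intermediate
    states, the latter scaled by [lam]. The two CFL bounds keep the remaining weight of [v]
    nonnegative. *)
Lemma lf_step (alpha : state -> state -> R) (lam om : R) (l v r : state) :
  0 < lam -> D v ->
  riemann_speed_bound D f U F l v (alpha l v) ->
  riemann_speed_bound D f U F v r (alpha v r) ->
  lam * alpha l v <= om / 2 -> lam * alpha v r <= om / 2 ->
  persp_epi D U om
    (om *: v - lam *: (lf_flux f alpha v r - lf_flux f alpha l v))
    (om * U v - lam * (lf_entropy_flux U F alpha v r - lf_entropy_flux U F alpha l v)).
Proof.
move=> lam0 Dv /lf_persp_epi[a0 H0] /lf_persp_epi[a1 H1] c0 c1.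
have [cU _ _] := EP.
have w0 : 0 <= om - lam * alpha l v - lam * alpha v r by lra.
have H := persp_epiD cD cU (persp_epi_point U w0 Dv)
  (persp_epiD cD cU (persp_epiZ (ltW lam0) H0) (persp_epiZ (ltW lam0) H1)).
have e1 : om - lam * alpha l v - lam * alpha v r
    + (lam * alpha l v + lam * alpha v r) = om by ring.
rewrite e1 in H.
suff [<- <-] : (om - lam * alpha l v - lam * alpha v r) *: v +
     (lam *: ((alpha l v / 2) *: (l + v) - 2^-1 *: (f v - f l)) +
      lam *: ((alpha v r / 2) *: (v + r) - 2^-1 *: (f r - f v))) =
    om *: v - lam *: (lf_flux f alpha v r - lf_flux f alpha l v) /\
    (om - lam * alpha l v - lam * alpha v r) * U v +
     (lam * (alpha l v / 2 * (U l + U v) - 2^-1 * (F v - F l)) +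
      lam * (alpha v r / 2 * (U v + U r) - 2^-1 * (F r - F v))) =
    om * U v - lam * (lf_entropy_flux U F alpha v r - lf_entropy_flux U F alpha l v).
  exact: H.
split; last by rewrite /lf_entropy_flux; field.
by rewrite /lf_flux; apply/rowP => j; rewrite !mxE; field.
Qed.

End LaxFriedrichs.

(** * Gauss-Lobatto quadrature *)

Section GaussLobatto.
Context {R : realType}.
Local Notation mu := (@lebesgue_measure R).

Lemma poly_antiderivative (P : {poly R}) : exists Q : {poly R}, Q^`() = P.
Proof.
exists (\poly_(i < (size P).+1) (P`_i.-1 / i%:R)).
apply/polyP => i; rewrite coef_deriv coef_poly ltnS /=.
case: ltnP => [iP|Pi]; last by rewrite mul0rn nth_default.
by rewrite -[LHS]mulr_natr divfK// pnatr_eq0.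
Qed.

Variables (N : nat) (xi om : nat -> R).
Hypothesis GL : gauss_lobatto N xi om.

Lemma gauss_lobatto_lt q r : (1 <= q)%N -> (q < r)%N -> (r <= N)%N -> xi q < xi r.
Proof.
have [_ _ lt _] := GL.
move=> q1; elim: r => // r IHr; rewrite ltnS leq_eqVlt => /orP[/eqP <-|qr] rN.
  by apply: lt; rewrite q1.
apply: lt_trans (IHr qr (ltnW rN)) _; apply: lt.
by rewrite rN andbT (leq_trans q1)// ltnW.
Qed.

Lemma gauss_lobatto_itv q : (1 <= q <= N)%N -> -1 <= xi q <= 1.
Proof.
move=> /andP[q1 qN]; have [x1 xN _ _] := GL; apply/andP; split.
  rewrite -x1; move: q1; rewrite leq_eqVlt => /orP[/eqP <- //|q1].
  by apply/ltW/gauss_lobatto_lt.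
rewrite -xN; move: (qN); rewrite leq_eqVlt => /orP[/eqP -> //|qN'].
exact/ltW/gauss_lobatto_lt.
Qed.

(* The rule is exact for the nonnegative nodal polynomial that vanishes at all
   nodes except the q-th: to second order at the interior nodes, to first order
   at the endpoints. *)
Lemma gauss_lobatto_weight_ge0 q : (1 < q < N)%N -> 0 <= om q.
Proof.
move=> /andP[q1 qN]; have [x1 xN lt ex] := GL.
pose s := [seq r <- index_iota 2 N | r != q].
pose P := (1 - 'X^2) * (\prod_(r <- s) ('X - (xi r)%:P)) ^+ 2.
have szs : size s = (N - 3)%N.
  have qi : q \in index_iota 2 N by rewrite mem_index_iota q1.
  have := count_predC (pred1 q) (index_iota 2 N).
  rewrite count_uniq_mem ?iota_uniq// qi size_iota size_filter => e.
  by apply: (@addnI 1); rewrite -[LHS]/(1 + count (predC (pred1 q)) _)%N e; lia.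
(* The degree is [2 + 2 (N - 3) = 2 N - 4], within the exactness range. *)
have szP : (size P + 2 <= 2 * N)%N.
  have s2 : size ((\prod_(r <- s) ('X - (xi r)%:P)) ^+ 2) = (2 * (N - 3)).+1.
    have := size_exp (\prod_(r <- s) ('X - (xi r)%:P)) 2.
    rewrite -(big_map xi xpredT (fun a => 'X - a%:P)) size_prod_XsubC size_map szs /=.
    have : (0 < size ((\prod_(a <- [seq xi r | r <- s]) ('X - a%:P)) ^+ 2)%R)%N.
      by rewrite size_poly_gt0 expf_neq0// monic_neq0// monic_prod_XsubC.
    by case: (size _) => //= n _ ->; rewrite mulnC.
  have s1 : (size (1 - 'X^2 : {poly R})%R <= 3)%N.
    apply: (leq_trans (size_polyD _ _)).
    by rewrite size_polyN size_polyXn size_poly1.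
  have : (size P <= (size (1 - 'X^2 : {poly R})%R
      + size ((\prod_(r <- s) ('X - (xi r)%:P)) ^+ 2)%R).-1)%N by exact: size_polyMleq.
  rewrite s2; lia.
have PE x : P.[x] = (1 - x ^+ 2) * (\prod_(r <- s) (x - xi r)) ^+ 2.
  have h1 : (1 - 'X^2 : {poly R}).[x] = 1 - x ^+ 2 by rewrite !hornerE.
  have h2 r : ('X - (xi r)%:P).[x] = x - xi r by rewrite !hornerE.
  by rewrite /P hornerM horner_exp horner_prod h1 (eq_bigr _ (fun r _ => h2 r)).
have Pge0 x : -1 <= x <= 1 -> 0 <= P.[x].
  by move=> /andP[h1 h2]; rewrite PE mulr_ge0 ?sqr_ge0//; nra.
have P0 r : (1 <= r <= N)%N -> r != q -> P.[xi r] = 0.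
  move=> /andP[r1 rN] rq; rewrite PE.
  have [->|nr1] := eqVneq r 1%N; first by rewrite x1 sqrrN expr1n subrr mul0r.
  have [->|nrN] := eqVneq r N; first by rewrite xN expr1n subrr mul0r.
  rewrite (big_rem r)/= ?subrr ?mul0r ?expr0n ?mulr0//.
  by rewrite mem_filter rq mem_index_iota; lia.
have Pq : 0 < P.[xi q].
  rewrite PE mulr_gt0//.
    have : -1 < xi q by rewrite -x1; apply: gauss_lobatto_lt => //; exact: ltnW.
    have : xi q < 1 by rewrite -xN; apply: gauss_lobatto_lt => //; exact: ltnW.
    by move=> h1 h2; nra.
  rewrite exprn_even_gt0//=.
  rewrite prodf_seq_neq0; apply/allP => r; rewrite mem_filter mem_index_iota.
  move=> /andP[rq /andP[r1 rN]] /=; rewrite subr_eq0.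
  have [qr|qr|e] := ltngtP q r; last by rewrite e eqxx in rq.
    by rewrite lt_eqF// gauss_lobatto_lt// ltnW.
  by rewrite gt_eqF// gauss_lobatto_lt// ltnW.
have := ex P szP; rewrite (bigD1_seq q) ?iota_uniq ?mem_index_iota//=; last first.
  by rewrite (ltnW q1) ltnS ltnW.
rewrite big_seq_cond big1 => [|r]; last first.
  by rewrite mem_index_iota ltnS => /andP[r1 rq]; rewrite P0// mulr0.
rewrite addr0 => e.
have : 0 <= om q * P.[xi q].
  rewrite e mulr_ge0 ?invr_ge0//; apply: Rintegral_ge0 => x /=.
  by rewrite in_itv /=; exact: Pge0.
by rewrite pmulr_lge0.
Qed.

Lemma gauss_lobatto_sum1 : (2 <= N)%N -> \sum_(1 <= q < N.+1) om q = 1.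
Proof.
move=> N2; have [_ _ _ ex] := GL.
have := ex 1; rewrite size_poly1 => /(_ ltac:(lia)).
under eq_bigr do rewrite hornerC mulr1.
move=> ->; under eq_Rintegral do rewrite hornerC.
rewrite Rintegral_cst_itv//.
by rewrite mul1r opprK mulVf// pnatr_eq0.
Qed.

Variables (xc dx : R).
Hypothesis dx0 : 0 < dx.

Lemma node_affine i q : node xc dx xi i q = xhalf xc dx (i - 1) + dx / 2 * (1 + xi q).
Proof. by rewrite /node /xhalf intrB; field. Qed.

Lemma xhalfB1 i : xhalf xc dx i = xhalf xc dx (i - 1) + dx.
Proof. by rewrite /xhalf intrB; ring. Qed.

Lemma node_first i : node xc dx xi i 1 = xhalf xc dx (i - 1).
Proof. by have [x1 _ _ _] := GL; rewrite node_affine x1 subrr mulr0 addr0. Qed.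

Lemma node_last i : node xc dx xi i N = xhalf xc dx i.
Proof. by have [_ xN _ _] := GL; rewrite node_affine xN (xhalfB1 i); field. Qed.

Lemma node_cell i q : (1 <= q <= N)%N -> cell xc dx i (node xc dx xi i q).
Proof.
move=> /gauss_lobatto_itv /andP[h1 h2]; rewrite /cell /= in_itv /= node_affine (xhalfB1 i).
have d1 : 0 <= dx * (1 + xi q) by rewrite mulr_ge0 ?(ltW dx0)//; lra.
have d2 : 0 <= dx * (1 - xi q) by rewrite mulr_ge0 ?(ltW dx0)//; lra.
by rewrite lerDl lerD2l; apply/andP; split; lra.
Qed.

(** Composition with the affine map [A] from the reference cell preserves the degree bound. The
    integrals are compared through antiderivatives: [(2 / dx) Q(A)] for [P(A)], and [Q] for [P]. *)
Lemma gauss_lobatto_cell (P : {poly R}) i : (size P + 2 <= 2 * N)%N ->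
  \sum_(1 <= q < N.+1) om q * P.[node xc dx xi i q]
  = dx^-1 * \int[mu]_(x in cell xc dx i) P.[x].
Proof.
move=> szP; have [_ _ _ ex] := GL.
have [Q QP] := poly_antiderivative P.
pose A : {poly R} := (xhalf xc dx (i - 1) + dx / 2)%:P + (dx / 2)%:P * 'X.
have dA : A^`() = (dx / 2)%:P by rewrite /A !poly.derivE; ring.
have AE x : A.[x] = xhalf xc dx (i - 1) + dx / 2 * (1 + x) by rewrite !hornerE; ring.
have szPA : (size (P \Po A) + 2 <= 2 * N)%N.
  apply: leq_trans szP; rewrite leq_add2r.
  have szA : (size A <= 2)%N.
    apply: (leq_trans (size_polyD _ _)); rewrite geq_max (leq_trans (size_polyC_leq1 _))//.
    apply: (leq_trans (size_polyMleq _ _)); rewrite size_polyX addn2 /= .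
    by rewrite ltnS size_polyC_leq1.
  have [->|P0] := eqVneq P 0; first by rewrite comp_poly0.
  apply: leq_trans (size_comp_poly_leq _ _) _.
  have : (0 < size P)%N by rewrite size_poly_gt0.
  by case: (size P) (size A) szA => [|m] [|[|[|n]]]//= _ _; rewrite ?muln0 ?muln1.
have := ex _ szPA.
rewrite (@Rintegral_horner _ _ ((2 / dx)%:P * (Q \Po A))); last 2 first.
- lra.
- rewrite derivM derivC mul0r add0r deriv_comp QP dA mulrCA -polyCM.
  by rewrite (_ : 2 / dx * (dx / 2) = 1) ?mulr1//; field; rewrite gt_eqF.
rewrite /cell (@Rintegral_horner _ P Q)//; last by rewrite (xhalfB1 i) lerDl ltW.
rewrite !hornerE !horner_comp !AE subrr mulr0 addr0.
have -> : xhalf xc dx (i - 1) + dx / 2 * (1 + 1) = xhalf xc dx i.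
  by rewrite (xhalfB1 i); field.
move=> e; transitivity (\sum_(1 <= q < N.+1) om q * (P \Po A).[xi q]).
  by apply: eq_bigr => q _; rewrite horner_comp AE node_affine.
by rewrite e; field; rewrite gt_eqF.
Qed.

End GaussLobatto.

(** * The limited scheme *)

Section Scheme.
Context {R : realType} {p : nat}.
Local Notation state := 'rV[R]_p.
Local Notation mu := (@lebesgue_measure R).

Lemma dotv_delta (a : state) j : dotv a (delta_mx 0 j) = a 0 j.
Proof.
rewrite /dotv (bigD1 j)//= mxE !eqxx mulr1 big1 ?addr0// => l lj.
by rewrite mxE eqxx (negbTE lj) mulr0.
Qed.

Lemma dotv0 (a : state) : dotv a 0 = 0.
Proof. by rewrite /dotv big1// => j _; rewrite mxE mulr0. Qed.

(* Testing with the constant unit vectors. *)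
Lemma dg_operator_mass (xc dx : R) (k : nat) f alpha (u Lu : @dgfun R p) i j :
  let fhat i := lf_flux f alpha (trace_minus xc dx u i) (trace_plus xc dx u i) in
  is_dg_operator xc dx k f alpha u Lu ->
  \int[mu]_(x in cell xc dx i) (Lu i 0 j).[x] = - (fhat i - fhat (i - 1)) 0 j.
Proof.
move=> fhat [_ H].
pose w : @dgfun R p := fun _ => map_mx polyC (delta_mx 0 j).
have wV i' x : dgval w i' x = delta_mx 0 j.
  by apply/rowP => l; rewrite !mxE hornerC.
have wd i' x : dgval (dg_deriv w) i' x = 0.
  by apply/rowP => l; rewrite !mxE derivC horner0.
have wk : in_Vh k w.
  by move=> i' l; rewrite mxE (leq_trans (size_polyC_leq1 _)).
have := H w wk i.
rewrite /trace_minus /trace_plus !wV !dotv_delta.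
have -> : \int[mu]_(x in cell xc dx i) dotv (dgval Lu i x) (dgval w i x) =
    \int[mu]_(x in cell xc dx i) (Lu i 0 j).[x].
  by apply: eq_Rintegral => x _; rewrite wV dotv_delta mxE.
move=> ->.
have -> : \int[mu]_(x in cell xc dx i) dotv (f (dgval u i x)) (dgval (dg_deriv w) i x) = 0.
  transitivity (\int[mu]_(x in cell xc dx i) (0 : R)).
    by apply: eq_Rintegral => x _; rewrite wd dotv0.
  by rewrite Rintegral_cst ?mul0r//; exact: measurable_itv.
have -> : (fhat i - fhat (i - 1)) 0 j = fhat i 0 j - fhat (i - 1) 0 j by rewrite !mxE.
by rewrite sub0r opprB addrC.
Qed.

Lemma in_Vh_forward_euler k dt (u Lu : @dgfun R p) : in_Vh k u -> in_Vh k Lu ->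
  in_Vh k (forward_euler dt u Lu).
Proof.
move=> hu hL i j; rewrite !mxE mul_polyC.
apply: (leq_trans (size_polyD _ _)); rewrite geq_max hu /=.
exact: leq_trans (size_scale_leq _ _) (hL i j).
Qed.

Lemma dgval_forward_euler dt (u Lu : @dgfun R p) i x :
  dgval (forward_euler dt u Lu) i x = dgval u i x + dt *: dgval Lu i x.
Proof. by apply/rowP => j; rewrite !mxE hornerD hornerM hornerC. Qed.

Lemma dgval_scale_about (c : state) theta (v : @dgfun R p) i x :
  dgval (fun i => scale_about c theta (v i)) i x =
  theta *: dgval v i x + (1 - theta) *: c.
Proof. by apply/rowP => j; rewrite !mxE !hornerE; ring. Qed.

(** * Cell entropy inequality and its summation over the mesh *)

Section Quadrature.
Variables (xc dx : R) (k N : nat) (xi om : nat -> R).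
Hypotheses (dx0 : 0 < dx) (kN : (k + 3 <= 2 * N)%N) (GL : gauss_lobatto N xi om).

Local Notation nd := (node xc dx xi).

Lemma cell_averageE (v : @dgfun R p) i j :
  cell_average xc dx v i 0 j = dx^-1 * \int[mu]_(x in cell xc dx i) (v i 0 j).[x].
Proof. by rewrite mxE; congr (_ * _); apply: eq_Rintegral => x _; rewrite mxE. Qed.

(** The condition [k + 3 <= 2 * N] puts every component within the exactness range. *)
Lemma cell_average_quad (v : @dgfun R p) i : in_Vh k v ->
  cell_average xc dx v i = \sum_(1 <= q < N.+1) om q *: dgval v i (nd i q).
Proof.
move=> vk; apply/rowP => j; rewrite cell_averageE summxE.
under eq_bigr do rewrite !mxE.
rewrite (gauss_lobatto_cell GL)//.
by have := vk i j; lia.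
Qed.

Lemma cell_quadE (g : int -> R -> R) i :
  dx^-1 * cell_quad xc dx N xi om g i = \sum_(1 <= q < N.+1) om q * g i (nd i q).
Proof. by rewrite /cell_quad mulKf// gt_eqF. Qed.

Variables (f : state -> state) (alpha : state -> state -> R) (dt : R).
Variables (u Lu : @dgfun R p).
Hypotheses (uk : in_Vh k u) (Lk : is_dg_operator xc dx k f alpha u Lu).

Local Notation um := (trace_minus xc dx u).
Local Notation up := (trace_plus xc dx u).
Local Notation upre := (forward_euler dt u Lu).
Local Notation lam := (dt / dx).

Lemma forward_euler_average i :
  cell_average xc dx upre i = \sum_(1 <= q < N.+1) om q *: dgval u i (nd i q)
    - lam *: (lf_flux f alpha (um i) (up i)
              - lf_flux f alpha (um (i - 1)) (up (i - 1))).
Proof.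
have Luk : in_Vh k Lu by case: Lk.
rewrite cell_average_quad; last exact: in_Vh_forward_euler.
under eq_bigr do rewrite dgval_forward_euler scalerDr.
rewrite big_split /=; congr (_ + _).
have -> : \sum_(1 <= q < N.+1) om q *: (dt *: dgval Lu i (nd i q))
    = dt *: cell_average xc dx Lu i.
  rewrite cell_average_quad// scaler_sumr; apply: eq_bigr => q _.
  by rewrite !scalerA mulrC.
apply/rowP => j; rewrite mxE cell_averageE (dg_operator_mass i j Lk).
by rewrite ![in RHS]mxE; rewrite ![in LHS]mxE; ring.
Qed.

Variables (D : set state) (U F : state -> R).
Hypotheses (oD : open D) (cD : convex_set D) (EP : entropy_pair D f U F).
Hypotheses (dt0 : 0 < dt) (Du : forall i x, cell xc dx i x -> D (dgval u i x)).
Hypothesis Dpre : forall i q, (1 <= q <= N)%N -> D (dgval upre i (nd i q)).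
Hypothesis speed1 :
  forall i, riemann_speed_bound D f U F (um i) (up i) (alpha (um i) (up i)).
Hypothesis speed2 : forall i,
  riemann_speed_bound D f U F (up (i - 1)) (um i) (alpha (up (i - 1)) (um i)).
Hypothesis cflN : forall i,
  lam * Num.max (alpha (up (i - 1)) (um i)) (alpha (um i) (up i)) <= om N / 2.
Hypothesis cfl1 : forall i,
  lam * Num.max (alpha (um (i - 1)) (up (i - 1))) (alpha (up (i - 1)) (um i))
    <= om 1%N / 2.

Local Notation Fhat i := (lf_entropy_flux U F alpha (um i) (up i)).

Local Notation unew := (es_limiter xc dx dt N xi om U F alpha u upre).

Let N2 : (2 <= N)%N. Proof. lia. Qed.

Let lam0 : 0 < lam. Proof. by rewrite divr_gt0. Qed.

Lemma cfl_split a b c : lam * Num.max a b <= c -> lam * a <= c /\ lam * b <= c.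
Proof.
move=> h; split; apply: le_trans h; rewrite ler_pM2l//.
  by rewrite le_max lexx.
by rewrite le_max lexx orbT.
Qed.

Lemma speed_ge0 i : 0 <= alpha (um i) (up i).
Proof. by have [] := lf_persp_epi oD cD EP (speed1 i). Qed.

Lemma speed_bounded i : alpha (um i) (up i) <= om N / 2 / lam.
Proof. by rewrite ler_pdivlMr// mulrC; have [] := cfl_split (cflN i). Qed.

(** At the two endpoints, the CFL conditions bound a nonnegative quantity by half the weight; at
    interior nodes exactness of the rule decides. *)
Lemma weight_ge0 q : (1 <= q <= N)%N -> 0 <= om q.
Proof.
move=> /andP[q1 qN].
have [->|qn1] := eqVneq q 1%N.
  have [+ _] := cfl_split (cfl1 0); have := speed_ge0 (0 - 1).
  by move=> /(mulr_ge0 (ltW lam0)) h1 h2; lra.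
have [->|qnN] := eqVneq q N.
  have [_ +] := cfl_split (cflN 0); have := speed_ge0 0.
  by move=> /(mulr_ge0 (ltW lam0)) h1 h2; lra.
by apply: (gauss_lobatto_weight_ge0 GL); lia.
Qed.

Lemma Du_node i q : (1 <= q <= N)%N -> D (dgval u i (nd i q)).
Proof. by move=> hq; apply: Du; exact: (node_cell GL). Qed.

Lemma up_node i : up (i - 1) = dgval u i (nd i 1).
Proof. by rewrite /trace_plus subrK (node_first GL). Qed.

Lemma um_node i : um i = dgval u i (nd i N).
Proof. by rewrite /trace_minus (node_last GL). Qed.

(** Inserting the flux between [up (i - 1)] and [um i] splits the update into a three-point step at
    the first node, one at the last node, and unchanged interior values. *)
Lemma persp_epi_average i : persp_epi D U 1 (cell_average xc dx upre i)
  (\sum_(1 <= q < N.+1) om q * U (dgval u i (nd i q)) - lam * (Fhat i - Fhat (i - 1))).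
Proof.
have [cU _ _] := EP.
have [c1 c2] := cfl_split (cfl1 i); have [c3 c4] := cfl_split (cflN i).
have Dp : D (up (i - 1)) by rewrite up_node; apply: Du_node; lia.
have Dm : D (um i) by rewrite um_node; apply: Du_node; lia.
have h1 := lf_step oD cD EP lam0 Dp (speed1 (i - 1)) (speed2 i) c1 c2.
have hN := lf_step oD cD EP lam0 Dm (speed2 i) (speed1 i) c3 c4.
have hmid : persp_epi D U (\sum_(2 <= q < N) om q)
    (\sum_(2 <= q < N) om q *: dgval u i (nd i q))
    (\sum_(2 <= q < N) om q * U (dgval u i (nd i q))).
  rewrite !big_nat; apply: persp_epi_sum => // q /andP[q1 qN].
  by apply: persp_epi_point; [apply: weight_ge0|apply: Du_node]; lia.
have split3 (W : nmodType) (g : nat -> W) :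
    \sum_(1 <= q < N.+1) g q = g 1%N + (\sum_(2 <= q < N) g q + g N).
  by rewrite big_ltn ?big_nat_recr //=; lia.
rewrite forward_euler_average -(gauss_lobatto_sum1 GL N2) !split3.
have := persp_epiD cD cU h1 (persp_epiD cD cU hmid hN).
rewrite up_node um_node.
have cast s x x' r r' : x = x' -> r = r' -> persp_epi D U s x r -> persp_epi D U s x' r'.
  by move=> -> ->.
apply: cast; last by ring.
by apply/rowP => j; rewrite !mxE; ring.
Qed.

(** By convexity at each node, the limited entropy is at most the interpolation between [U^1st] and
    [U^high] with parameter [theta], which was chosen to stay below [U^up]. *)
Lemma es_limiter_cell i :
  \sum_(1 <= q < N.+1) om q * U (dgval unew i (nd i q)) <=
  \sum_(1 <= q < N.+1) om q * U (dgval u i (nd i q)) - lam * (Fhat i - Fhat (i - 1)).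
Proof.
have [cU _ _] := EP.
have [Dbar U1st_up] := persp_epi1 (persp_epi_average i).
set Uup := _ - _ in U1st_up *; set ubar := cell_average _ _ _ _ in Dbar U1st_up.
pose Uhigh := \sum_(1 <= q < N.+1) om q * U (dgval upre i (nd i q)).
(* Discrete Jensen inequality: the cell average is also the quadrature average of the nodal
   values. *)
have U1st_high : U ubar <= Uhigh.
  have : persp_epi D U (\sum_(1 <= q < N.+1) om q)
      (\sum_(1 <= q < N.+1) om q *: dgval upre i (nd i q)) Uhigh.
    rewrite /Uhigh !big_nat; apply: persp_epi_sum => // q /andP[q1 qN].
    by apply: persp_epi_point; [apply: weight_ge0|apply: Dpre]; lia.
  rewrite (gauss_lobatto_sum1 GL N2) -cell_average_quad; last first.
    by apply: in_Vh_forward_euler => //; case: Lk.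
  by move/persp_epi1 => [].
pose theta := es_theta Uup (U ubar) Uhigh.
have unewE q : dgval unew i (nd i q)
    = theta *: dgval upre i (nd i q) + (1 - theta) *: ubar.
  have := dgval_scale_about ubar theta upre i (nd i q) => <-.
  by rewrite /es_limiter /dgval !cell_quadE.
have [th0 th1 thle] : [/\ 0 <= theta, theta <= 1 &
    theta * (Uhigh - U ubar) <= Uup - U ubar].
  (* When [U^high = U^1st], the value [theta = 1] is admissible because [U^1st <= U^up]. *)
  rewrite /theta /es_theta; case: eqVneq => [->|ne].
    by rewrite ler01 lexx mul1r subrr subr_ge0.
  have d0 : 0 < Uhigh - U ubar by rewrite subr_gt0 lt_neqAle eq_sym ne.
  split.
  - by rewrite le_min ler01 andbT divr_ge0 ?subr_ge0.
  - by rewrite ge_min lexx orbT.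
  - by rewrite -ler_pdivlMr// ge_min lexx.
apply: (@le_trans _ _ (theta * Uhigh + (1 - theta) * U ubar)); last by lra.
have -> : theta * Uhigh + (1 - theta) * U ubar = \sum_(1 <= q < N.+1)
    om q * (theta * U (dgval upre i (nd i q)) + (1 - theta) * U ubar).
  under eq_bigr do rewrite mulrDr mulrCA.
  rewrite big_split /= -mulr_sumr -/Uhigh; congr (_ + _).
  by rewrite -mulr_suml (gauss_lobatto_sum1 GL N2) mul1r.
rewrite !big_nat; apply: ler_sum => q /andP[q1 qN].
rewrite unewE ler_wpM2l//; first by apply: weight_ge0; lia.
by apply: convex_functionP => //; apply: Dpre; lia.
Qed.

(** The cells [|i| <= m] have outer interfaces at [m + 1/2] and [-m - 1/2], encoded as [m] and
    [- m - 1]; only their fluxes survive telescoping. *)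
Lemma es_limiter_partial m :
  line_quad_partial xc dx N xi om (fun i x => U (dgval unew i x)) m <=
  line_quad_partial xc dx N xi om (fun i x => U (dgval u i x)) m
    - dt * (Fhat m%:Z - Fhat (- m%:Z - 1)).
Proof.
have -> : Fhat m%:Z - Fhat (- m%:Z - 1) = \sum_(j < m.*2.+1)
    (Fhat (j%:Z - m%:Z) - Fhat (j%:Z - m%:Z - 1)).
  rewrite -(big_mkord xpredT (fun j : nat => Fhat (j%:Z - m%:Z) - Fhat (j%:Z - m%:Z - 1))).
  rewrite (eq_bigr (fun j : nat => Fhat (j.+1%:Z - m%:Z - 1) - Fhat (j%:Z - m%:Z - 1))).
    rewrite (telescope_sumr (fun j : nat => Fhat (j%:Z - m%:Z - 1)))//.
    have -> : m.*2.+1%:Z - m%:Z - 1 = m%:Z by lia.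
    by rewrite sub0r.
  by move=> j _; have -> : j.+1%:Z - m%:Z - 1 = j%:Z - m%:Z by lia.
rewrite mulr_sumr -sumrB /line_quad_partial; apply: ler_sum => j _.
have h := es_limiter_cell (j%:Z - m%:Z); rewrite -(ler_pM2l dx0) in h.
rewrite /cell_quad; apply: le_trans h _.
by rewrite mulrBr lerB// mulrA [dx * _]mulrC divfK// gt_eqF.
Qed.

(** The sequence [s] covers both ends of the line. No continuity of [alpha] is at hand: boundedness
    suffices, as it multiplies a jump of [U] that tends to zero. *)
Lemma far_field_entropy_flux (uinf : state) (s : nat -> int) : D uinf ->
  far_field xc dx u uinf -> (forall m, (m <= `|s m|)%N) ->
  (fun m => Fhat (s m)) @ \oo --> F uinf.
Proof.
move=> Dinf ff hs; have [_ C2U dF] := EP.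
have cvg_trace (tr : int -> state) :
    (forall e : R, 0 < e -> exists M : nat, forall i : int, (M < `|i|)%N -> `|tr i - uinf| < e) ->
    (fun m => tr (s m)) @ \oo --> uinf.
  move=> h; apply/cvgrPdist_lt => e e0; have [M hM] := h e e0.
  near=> m; rewrite distrC; apply: hM; apply: leq_trans (hs m).
  by near: m; exact: nbhs_infty_gt.
have cm : (fun m => um (s m)) @ \oo --> uinf.
  by apply: cvg_trace => e /ff[M hM]; exists M => i /hM[].
have cp : (fun m => up (s m)) @ \oo --> uinf.
  by apply: cvg_trace => e /ff[M hM]; exists M => i /hM[].
have cF : {for uinf, continuous F} by apply: differentiable_continuous; case: (dF _ Dinf).
have cU : {for uinf, continuous U} by apply: differentiable_continuous; case: (C2U _ Dinf).
have Fm : (fun m => F (um (s m))) @ \oo --> F uinf by exact: continuous_cvg.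
have Fp : (fun m => F (up (s m))) @ \oo --> F uinf by exact: continuous_cvg.
have Um : (fun m => U (um (s m))) @ \oo --> U uinf by exact: continuous_cvg.
have Up : (fun m => U (up (s m))) @ \oo --> U uinf by exact: continuous_cvg.
have dU : (fun m => U (up (s m)) - U (um (s m))) @ \oo --> (0 : R).
  by rewrite -(subrr (U uinf)); exact: cvgB.
have aU : (fun m => alpha (um (s m)) (up (s m)) * (U (up (s m)) - U (um (s m))))
    @ \oo --> (0 : R).
  (* The uniform bound on the interface speeds supplied by the CFL condition. *)
  pose A := om N / 2 / lam.
  apply: norm_cvg0.
  have := cvg_norm dU; rewrite normr0 => nU.
  have nA : (fun m => A * `|U (up (s m)) - U (um (s m))|) @ \oo --> A * 0.
    by apply: cvgMl_tmp; exact: nU.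
  rewrite mulr0 in nA.
  apply: (squeeze_cvgr _ (cvg_cst 0) nA); apply: nearW => m.
  rewrite normr_ge0 normrM /= ger0_norm ?speed_ge0//.
  by rewrite ler_wpM2r// speed_bounded.
have -> : F uinf = 2^-1 * (F uinf + F uinf) - 2^-1 * 0 by field.
rewrite /lf_entropy_flux; under eq_fun do rewrite -[2^-1 * alpha _ _ * _]mulrA.
by apply: cvgB; apply: cvgMl_tmp => //; exact: cvgD.
Unshelve. all: by end_near. Qed.

End Quadrature.
End Scheme.

Theorem theorem4p4 (R : realType) (p k N : nat)
  (D : set 'rV[R]_p) (f : 'rV[R]_p -> 'rV[R]_p) (U F : 'rV[R]_p -> R)
  (alpha : 'rV[R]_p -> 'rV[R]_p -> R)
  (xc dx dt : R) (xi om : nat -> R) (u Lu : @dgfun R p) (uinf : 'rV[R]_p) :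
  let lam := dt / dx in
  let um := trace_minus xc dx u in
  let up := trace_plus xc dx u in
  let upre := forward_euler dt u Lu in
  let unew := es_limiter xc dx dt N xi om U F alpha u upre in
  let Uof (v : @dgfun R p) := fun i x => U (dgval v i x) in
  (* the system and its entropy pair *)
  open D -> convex_set D ->
  (forall v, D v -> differentiable f v) ->
  entropy_pair D f U F ->
  (* mesh, time step, quadrature *)
  0 < dx -> 0 < dt ->
  (k + 3 <= 2 * N)%N -> gauss_lobatto N xi om ->
  (* the DG solution at the old time level and the DG operator *)
  in_Vh k u ->
  (forall i x, cell xc dx i x -> D (dgval u i x)) ->
  is_dg_operator xc dx k f alpha u Lu ->
  (forall i q, (1 <= q <= N)%N -> D (dgval upre i (node xc dx xi i q))) ->
  (* alpha bounds the speeds of the Riemann problems with states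
     (u_{i+1/2}^-, u_{i+1/2}^+) and (u_{i-1/2}^+, u_{i+1/2}^-) *)
  (forall i, riemann_speed_bound D f U F (um i) (up i) (alpha (um i) (up i))) ->
  (forall i, riemann_speed_bound D f U F (up (i - 1)) (um i)
               (alpha (up (i - 1)) (um i))) ->
  (* CFL conditions *)
  (forall i, lam * Num.max (alpha (up (i - 1)) (um i)) (alpha (um i) (up i))
               <= om N / 2) ->
  (forall i, lam * Num.max (alpha (um (i - 1)) (up (i - 1)))
                           (alpha (up (i - 1)) (um i)) <= om 1%N / 2) ->
  (* constant state at infinity, and convergence of the two total entropies *)
  D uinf -> far_field xc dx u uinf ->
  cvgn (line_quad_partial xc dx N xi om (Uof u)) ->
  cvgn (line_quad_partial xc dx N xi om (Uof unew)) ->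
  line_quad xc dx N xi om (Uof unew) <= line_quad xc dx N xi om (Uof u).
Proof.
move=> lam um up upre unew Uof oD cD _ EP dx0 dt0 kN GL uk Du Lk Dpre sp1 sp2.
move=> cflN cfl1 Dinf ff cold cnew.
have Fpos : (fun m : nat => lf_entropy_flux U F alpha (um m%:Z) (up m%:Z)) @ \oo --> F uinf.
  exact: (@far_field_entropy_flux _ _ xc dx N om dx0 f alpha dt u D U F
    oD cD EP dt0 sp1 cflN uinf (fun m : nat => m%:Z)).
have Fneg : (fun m : nat => lf_entropy_flux U F alpha (um (- m%:Z - 1)) (up (- m%:Z - 1)))
    @ \oo --> F uinf.
  apply: (@far_field_entropy_flux _ _ xc dx N om dx0 f alpha dt u D U F
    oD cD EP dt0 sp1 cflN uinf (fun m : nat => - m%:Z - 1)) => // m; lia.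
(* Both end fluxes tend to [F uinf], so the correction disappears in the limit and the inequality
   between partial sums passes to their limits. *)
have bound : (fun m : nat => line_quad_partial xc dx N xi om (Uof u) m
    - dt * (lf_entropy_flux U F alpha (um m%:Z) (up m%:Z)
        - lf_entropy_flux U F alpha (um (- m%:Z - 1)) (up (- m%:Z - 1))))
    @ \oo --> line_quad xc dx N xi om (Uof u).
  rewrite -[X in _ --> X]subr0 -[X in _ - X](mulr0 dt) -(subrr (F uinf)).
  by apply: cvgB => //; apply: cvgMl_tmp; exact: cvgB.
apply: (ler_cvg_to cnew bound); apply: nearW => m.
exact: (es_limiter_partial dx0 kN GL uk Lk oD cD EP dt0 Du Dpre sp1 sp2 cflN cfl1).
Qed.
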